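(* Let $\mathcal{A}$ be a commutative C$^\ast$-algebra, $\Phi:\mathcal{A}\to\mathcal{A}$ an isometric $\ast$-isomorphism, and $b=(b_j)_{j\in\mathbb{Z}}\subseteq\mathcal{A}$ a sequence with $\sup_{j\in\mathbb{Z}}\|b_j\|<\infty$. Let $(T_{\Phi,b,n})_{n\in\mathbb{N}_0}$ be the associated sequence of generalized bilateral shift operators on $\ell^2(\mathcal{A})$. Consider the statements: (1) The sequence $(T_{\Phi,b,n})_{n\in\mathbb{N}_0}$ is hypercyclic. (2) For every non-empty compact subset $K$ of $\sigma(\mathcal{A})$ and each non-empty finite subset $I$ of $\mathbb{N}$ there exists a strictly increasing sequence $(r_k)_{k\in\mathbb{N}}$ in $\mathbb{N}$ such that $$\lim_{k\to\infty}\left(\sup_{h\in K}\prod_{i=1}^{r_k}\left|h\big(\Phi^{-i}(b_{i+j})\big)\right|\right)=\lim_{k\to\infty}\left(\sup_{h\in K}\prod_{i=1}^{r_k}\left|h\big(\Phi^{i-1}(b_{j-i+1})\big)\right|^{-1}\right)=0$$ for all $j\in I$. Then (1) implies (2). Moreover, if $\mathcal{A}$ is unital and each $b_j$ is invertible in $\mathcal{A}$ with $\sup_{j\in\mathbb{Z}}\|b_j^{-1}\|<\infty$, then (2) implies (1).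
   Context: $\mathbb{N}=\{1,2,\dots\}$, $\mathbb{N}_0=\mathbb{N}\cup\{0\}$. $\sigma(\mathcal{A})$ is the spectrum (character space) of $\mathcal{A}$. $\ell^2(\mathcal{A})$ is the standard Hilbert module over $\mathcal{A}$: the space of sequences $a=(a_j)_{j\in\mathbb{Z}}$ in $\mathcal{A}$ such that $\sum_j a_j^*a_j$ converges in norm, with norm $\|a\|_2=\|\sum_j a_j^*a_j\|^{1/2}$. For $n\in\mathbb{N}$, $$T_{\Phi,b,n}:\ell^2(\mathcal{A})\to\ell^2(\mathcal{A}),\qquad (T_{\Phi,b,n}(a))_j=\Big[\prod_{k=1}^{n}\Phi^{n-k}(b_{j-n+k})\Big]\Phi^n(a_{j-n})\quad (j\in\mathbb{Z}),$$ and $T_{\Phi,b,0}$ is the identity. A sequence $(T_n)_{n\in\mathbb{N}_0}$ of bounded linear operators on a Banach space $\mathcal{X}$ is hypercyclic if there is $x\in\mathcal{X}$ such that $\{T_nx:n\in\mathbb{N}_0\}$ is dense in $\mathcal{X}$. Standing assumption: the Banach spaces on which the operators act are separable and infinite-dimensional. Convention: $0^{-1}=+\infty$. *)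

(* Defs.v *)
From HB Require Import structures.
From mathcomp Require Import all_boot all_order all_algebra.
From mathcomp Require Import all_classical all_reals all_analysis.
From mathcomp Require Import complex summability.
Import Order.TTheory GRing.Theory Num.Theory.
Import numFieldNormedType.Exports.

Set Implicit Arguments.
Unset Strict Implicit.
Unset Printing Implicit Defensive.

Local Open Scope classical_set_scope.
Local Open Scope ring_scope.

(* The norm of a normedModType over R[i] takes its values in R[i] (in the
   nonnegative reals); rnorm is the same norm with values in R. On R[i] itself
   it is the modulus. *)
Definition rnorm (R : realType) (V : normedZmodType R[i]) (v : V) : R :=
  complex.Re `|v|.

(* Not necessarily unital: MathComp has no structure for rings without unit,
   so the product is part of the mixin. *)
HB.mixin Record isCStarAlgebra (R : realType) A
    of CompleteNormedModule R[i] A := {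
  cmul : A -> A -> A;
  adj : A -> A;
  cmulA : associative cmul;
  cmulDl : forall x y z, cmul (x + y) z = cmul x z + cmul y z;
  cmulDr : forall x y z, cmul x (y + z) = cmul x y + cmul x z;
  cmulZl : forall (c : R[i]) x y, cmul (c *: x) y = c *: cmul x y;
  cmulZr : forall (c : R[i]) x y, cmul x (c *: y) = c *: cmul x y;
  adjK : involutive adj;
  adjD : forall x y, adj (x + y) = adj x + adj y;
  adjZ : forall (c : R[i]) x, adj (c *: x) = Num.conj c *: adj x;
  adjM : forall x y, adj (cmul x y) = cmul (adj y) (adj x);
  norm_cmul : forall x y, `|cmul x y| <= `|x| * `|y|;
  norm_cstar : forall x, `|cmul (adj x) x| = `|x| ^+ 2
}.

#[short(type="cstarAlgType")]
HB.structure Definition CStarAlgebra (R : realType) :=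
  {A of isCStarAlgebra R A & CompleteNormedModule R[i] A}.

(* A normed space is given here as a subset X of an ambient vector space V
   together with a function N on V that is the norm on X. *)
Section NormedSubspace.
Variables (R : realType) (V : lmodType R[i]) (X : set V) (N : V -> R).

Definition dense_in (D : set V) : Prop :=
  D `<=` X /\
  forall y, X y -> forall e : R, 0 < e -> exists2 x, D x & N (x - y) < e.

Definition separable : Prop :=
  exists2 D : set V, countable D & dense_in D.

Definition infinite_dimensional : Prop :=
  forall (n : nat) (e : 'I_n -> V), (forall i, X (e i)) ->
  exists2 v, X v & forall c : 'I_n -> R[i], v <> \sum_(i < n) c i *: e i.

Definition hypercyclic (T : nat -> V -> V) : Prop :=
  exists2 x, X x & dense_in (range (fun n => T n x)).

End NormedSubspace.

Section CStarAlgebraTheory.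
Variables (R : realType) (A : cstarAlgType R).

Definition is_unit_of (e : A) : Prop :=
  forall x : A, cmul e x = x /\ cmul x e = x.

(* Phi is an isometric *-isomorphism with inverse PhiV. *)
Record isometric_star_iso (Phi PhiV : A -> A) : Prop := IsometricStarIso {
  isoK : cancel Phi PhiV;
  isoVK : cancel PhiV Phi;
  iso_linear : linear Phi;
  isoM : {morph Phi : x y / cmul x y};
  iso_adj : {morph Phi : x / adj x};
  iso_isometry : forall x, `|Phi x| = `|x|
}.

(* Nonzero multiplicative linear functionals, with the weak-* topology, that
   is, the topology of pointwise convergence. *)
Definition spectrum : set {ptws A -> R[i]^o} :=
  [set h | [/\ forall (c : R[i]) (x y : A), h (c *: x + y) = c * h x + h y,
               forall x y : A, h (cmul x y) = h x * h y
             & exists x : A, h x <> 0]].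

(* Convergence of a series indexed by Z is along the directed set of finite
   subsets of Z. *)
Definition l2 : set (int -> A) :=
  [set a | cvg (partial_sum (fun j => cmul (adj (a j)) (a j)) @ totally)].

Definition l2norm (a : int -> A) : R :=
  Num.sqrt (rnorm (summability.sum (fun j => cmul (adj (a j)) (a j)))).

(* The product is nested to the right and ends with Phi^n(a_{j-n}) in place of
   the neutral element, which A need not have: for n = 0 this is a_j. *)
Definition bilateral_shift (Phi : A -> A) (b : int -> A) (n : nat) (a : int -> A) :
    int -> A :=
  fun j => \big[@cmul R A/iter n Phi (a (j - n%:Z))]_(1 <= k < n.+1)
             iter (n - k) Phi (b (j - n%:Z + k%:Z)).

(* The values are in \bar R, where 0^-1 = +oo. *)
Definition weight_condition (Phi PhiV : A -> A) (b : int -> A) : Prop :=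
  forall K : set {ptws A -> R[i]^o},
    K !=set0 -> compact K -> K `<=` spectrum ->
  forall I : set nat,
    I !=set0 -> finite_set I -> (forall j, I j -> (0 < j)%N) ->
  exists r : nat -> nat,
    [/\ forall k, (0 < r k)%N,
        {homo r : k l / (k < l)%N}
      & forall j : nat, I j ->
        (fun k => ereal_sup
          [set (\prod_(1 <= i < (r k).+1)
                 (rnorm (h (iter i PhiV (b (i%:Z + j%:Z)))))%:E)%E | h in K])
          @ \oo --> 0%E
        /\
        (fun k => ereal_sup
          [set (\prod_(1 <= i < (r k).+1)
                 ((rnorm (h (iter i.-1 Phi (b (j%:Z - i%:Z + 1)))))%:E)^-1)%E
          | h in K])
          @ \oo --> 0%E].

End CStarAlgebraTheory.

Arguments l2 {R} A _.
Arguments l2norm {R} A _.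
Arguments spectrum {R} A _.

(* Main.v *)
(** (1) implies (2).  A character [h] of [A] is a bounded *-homomorphism, so that
    [|h (a j)| <= ||a||_2] and [h ((T^n a) j)] is an explicit product of values of [h] on
    the weights times a value of [h] on a coordinate of [a].  Take [f] in [A] that
    is at least 1 in modulus on [K] and let [y] be [f] on the coordinates in [I] and 0
    elsewhere.  By hypercyclicity some [x] close to [y] has [T^n x] close to [y] with [n]
    large; comparing the coordinates [j + n] and [j] of [T^n x], for [j] in [I],
    bounds the two products.

    (2) implies (1).  Now [A] is unital, its spectrum is compact, and norms are
    suprema over the spectrum, so (2) for [K] the whole spectrum and [I = {1}] says that
    [T^(r k)] and [T^(- r k)] tend to 0 on the vectors supported at the coordinate 1, hence
    on all finitely supported vectors as [T] is boundedly invertible.  With [(Y k)]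
    running infinitely often through a countable dense family of such vectors, the vector
    [sum_k T^(- n k) (Y k)] is hypercyclic for a rapidly increasing [n].  All estimates
    are made for the norm of l^1, which dominates that of l^2.

    The norm formula is obtained without spectral theory: by Zorn's lemma there is a minimal
    power-multiplicative seminorm [p] among those with [p (x y) = |x| p y]; minimality
    makes [p] multiplicative, and an argument of Mazur shows that [p = |h|] for a
    character [h]. *)

From mathcomp Require Import all_boot all_order all_algebra finmap.
From mathcomp Require Import all_classical all_reals all_analysis.
From mathcomp Require Import complex summability ring lra zify.
Require Import Defs.
Import Order.TTheory GRing.Theory Num.Theory.
Import numFieldNormedType.Exports.

Set Implicit Arguments.
Unset Strict Implicit.
Unset Printing Implicit Defensive.

Local Open Scope classical_set_scope.
Local Open Scope ring_scope.
Local Open Scope complex_scope.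

(** * Real-valued norms *)

Section RealValuedNorm.
Variable R : realType.
Implicit Types V : normedZmodType R[i].

Lemma rnormE V (v : V) : `|v| = (rnorm v)%:C.
Proof. by rewrite /rnorm RRe_real// normr_real. Qed.

Lemma rnorm_ge0 V (v : V) : 0 <= rnorm v.
Proof. by rewrite -ler0c -rnormE normr_ge0. Qed.

Lemma ler_rnormD V (u v : V) : rnorm (u + v) <= rnorm u + rnorm v.
Proof. by rewrite -lecR rmorphD/= -!rnormE ler_normD. Qed.

Lemma rnorm0 V : rnorm (0 : V) = 0.
Proof. by rewrite /rnorm normr0. Qed.

Lemma rnormN V (v : V) : rnorm (- v) = rnorm v.
Proof. by rewrite /rnorm normrN. Qed.

Lemma rdistrC V (u v : V) : rnorm (u - v) = rnorm (v - u).
Proof. by rewrite -opprB rnormN. Qed.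

Lemma ler_rnormB V (u v : V) : rnorm (u - v) <= rnorm u + rnorm v.
Proof. by rewrite -[rnorm v]rnormN ler_rnormD. Qed.

Lemma rnorm0_eq0 V (v : V) : rnorm v = 0 -> v = 0.
Proof. by move=> v0; apply/normr0_eq0; rewrite rnormE v0. Qed.

Lemma rnorm_gt0 V (v : V) : v != 0 -> 0 < rnorm v.
Proof.
move=> v0; rewrite lt_neqAle rnorm_ge0 andbT eq_sym.
by apply: contra_neq v0; exact: rnorm0_eq0.
Qed.

Lemma ler_rnorm_sum V (I : Type) (s : seq I) (P : pred I) (F : I -> V) :
  rnorm (\sum_(i <- s | P i) F i) <= \sum_(i <- s | P i) rnorm (F i).
Proof.
elim/big_rec2 : _ => [|i y x _ le_xy]; first by rewrite rnorm0.
by rewrite (le_trans (ler_rnormD _ _))// lerD2l.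
Qed.

Lemma rnormZ (V : normedModType R[i]) (c : R[i]) (v : V) :
  rnorm (c *: v) = rnorm c * rnorm v.
Proof. by apply: complexI; rewrite rmorphM/= -!rnormE normrZ. Qed.

Lemma rnormM (x y : R[i]) : rnorm (x * y) = rnorm x * rnorm y.
Proof. by apply: complexI; rewrite rmorphM/= -!rnormE normrM. Qed.

Lemma rnormX (x : R[i]) n : rnorm (x ^+ n) = rnorm x ^+ n.
Proof. by apply: complexI; rewrite rmorphXn/= -!rnormE normrX. Qed.

Lemma rnormV (x : R[i]) : rnorm (x^-1) = (rnorm x)^-1.
Proof. by apply: complexI; rewrite fmorphV/= -!rnormE normfV. Qed.

Lemma rnorm1 : rnorm (1 : R[i]) = 1.
Proof. by apply: complexI; rewrite -rnormE normr1. Qed.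

Lemma rnorm_prod (I : Type) (s : seq I) (P : pred I) (F : I -> R[i]) :
  rnorm (\prod_(i <- s | P i) F i) = \prod_(i <- s | P i) rnorm (F i).
Proof. exact: (big_morph _ rnormM rnorm1). Qed.

Lemma rnorm_sqr (z : R[i]) : rnorm z ^+ 2 = complex.Re z ^+ 2 + complex.Im z ^+ 2.
Proof. by apply: complexI; rewrite rmorphXn/= -rnormE add_Re2_Im2. Qed.

Lemma rnorm_real (x : R) : rnorm x%:C = `|x|.
Proof. by rewrite /rnorm normc_def/= expr0n addr0 sqrtr_sqr. Qed.

Lemma ger0_rnorm (x : R) : 0 <= x -> rnorm x%:C = x.
Proof. by move=> x0; rewrite rnorm_real ger0_norm. Qed.

Lemma cvg_rnormP (V : normedModType R[i]) (T : Type) (F : set_system T)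
    {FF : Filter F} (f : T -> V) (l : V) :
  f @ F --> l <-> forall e : R, 0 < e -> \forall t \near F, rnorm (l - f t) < e.
Proof.
split=> [/cvgrPdist_lt fl e e0|fl].
  by have := fl e%:C; rewrite ltcR => /(_ e0); apply: filterS => t; rewrite rnormE ltcR.
(* A positive element of [R[i]] has imaginary part 0, so every such radius comes from [R]. *)
apply/cvgrPdist_lt => -[a b]; rewrite ltcE/= => /andP[/eqP -> a0].
by apply: filterS (fl _ a0) => t; rewrite rnormE ltcR.
Qed.

End RealValuedNorm.

(** * C*-algebras and characters *)

Lemma exprn_lt_near (R : realType) (q e : R) :
  0 <= q -> q < 1 -> 0 < e -> exists n, q ^+ n < e.
Proof.
move=> q0 q1 e0; have /cvgrPdist_lt/(_ e e0)[n _ Hn] : (GRing.exp q) @ \oo --> (0:R).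
  by apply: cvg_expr; rewrite ger0_norm.
by exists n; have := Hn n (leqnn n); rewrite sub0r normrN ger0_norm ?exprn_ge0.
Qed.

Lemma rcauchy_cvg (R : realType) (V : completeNormedModType R[i]) (T : Type)
    (F : set_system T) {FF : ProperFilter F} (f : T -> V) :
  (forall e : R, 0 < e -> exists x, \forall t \near F, rnorm (x - f t) < e) ->
  cvg (f @ F).
Proof.
move=> fC; apply: cauchy_cvg; apply: cauchy_exP => -[a b].
rewrite ltcE/= => /andP[/eqP -> a0]; have [x xF] := fC a a0.
by exists x; apply: filterS xF => t; rewrite -ball_normE/= rnormE ltcR.
Qed.

Section CStarBasics.
Variables (R : realType) (A : cstarAlgType R).
Implicit Types x y z : A.

Lemma cmul0 x : cmul x 0 = 0.
Proof. by have := cmulZr 0 x 0; rewrite !scale0r. Qed.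

Lemma cmul0l x : cmul 0 x = 0.
Proof. by have := cmulZl 0 0 x; rewrite !scale0r. Qed.

Lemma cmulBr x y z : cmul x (y - z) = cmul x y - cmul x z.
Proof. by rewrite cmulDr -scaleN1r cmulZr scaleN1r. Qed.

Lemma cmulBl x y z : cmul (x - y) z = cmul x z - cmul y z.
Proof. by rewrite cmulDl -scaleN1r cmulZl scaleN1r. Qed.

Lemma rnorm_cmul x y : rnorm (cmul x y) <= rnorm x * rnorm y.
Proof. by rewrite -lecR rmorphM/= -!rnormE norm_cmul. Qed.

Lemma rnorm_cstar x : rnorm (cmul (adj x) x) = rnorm x ^+ 2.
Proof. by apply: complexI; rewrite rmorphXn/= -!rnormE norm_cstar. Qed.

Lemma adj0 : adj (0 : A) = 0.
Proof. by have := adjZ 0 (0 : A); rewrite conjC0 !scale0r. Qed.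

(** The norm identity gives [|y|^2 = |adj y y| <= |adj y| |y|]; cancel [|y|], and use the result for
    both [x] and [adj x]. *)
Lemma rnorm_adj x : rnorm (adj x) = rnorm x.
Proof.
have le_adj y : rnorm y <= rnorm (adj y).
  have [->|y0] := eqVneq y 0; first by rewrite adj0 rnorm0.
  have := rnorm_cmul (adj y) y.
  by rewrite rnorm_cstar expr2 ler_pM2r// rnorm_gt0.
by apply/eqP; rewrite eq_le le_adj -{2}[x]adjK le_adj.
Qed.

(** [z] is the Neumann series [y + y^2 + ...] and [u n] its n-th partial sum. Formally
    [(1 - y)(1 + z) = 1], written so as to make sense without a unit. *)
Lemma quasi_inverse y : rnorm y < 1 -> exists z, z = y + cmul y z.
Proof.
move=> y1; have y0 := rnorm_ge0 y; set q := rnorm y in y0 y1.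
pose u n := iter n (fun z => y + cmul y z) 0.
have uB n : rnorm (u n) <= q / (1 - q).
  elim: n => [|n IH]; first by rewrite /u/= rnorm0 divr_ge0//; lra.
  rewrite /u iterS -/(u n) (le_trans (ler_rnormD _ _))//.
  have -> : q / (1 - q) = q + q * (q / (1 - q)) by field; lra.
  by rewrite lerD// (le_trans (rnorm_cmul _ _))// ler_wpM2l.
have uC n k : rnorm (u n - u (n + k)%N) <= q ^+ n * (q / (1 - q)).
  elim: n => [|n IH]; first by rewrite add0n /u/= sub0r rnormN expr0 mul1r uB.
  rewrite addSn /u !iterS -!/(u _) opprD addrACA subrr add0r -cmulBr.
  by rewrite (le_trans (rnorm_cmul _ _))// exprS -mulrA ler_wpM2l.
(* Adding 1 keeps this a legitimate divisor when [y = 0]. *)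
have Q0 : 0 < q / (1 - q) + 1 by rewrite ltr_wpDl// divr_ge0//; lra.
have small (e : R) : 0 < e -> exists n, q ^+ n * (q / (1 - q)) < e.
  move=> e0; have [|n Hn] := @exprn_lt_near R q (e / (q / (1 - q) + 1)) y0 y1.
    by rewrite divr_gt0.
  exists n; move: Hn; rewrite ltr_pdivlMr//; apply: le_lt_trans.
  by rewrite ler_wpM2l ?exprn_ge0// lerDl.
have /cvg_ex[z /cvg_rnormP uz] : cvg (u @ \oo).
  apply: rcauchy_cvg => e /small[n Hn]; exists (u n), n => // k/= /subnKC <-.
  by apply: le_lt_trans Hn; exact: uC.
exists z; apply/eqP; rewrite -subr_eq0; apply/eqP/rnorm0_eq0/eqP.
rewrite eq_le rnorm_ge0 andbT; apply/ler_addgt0Pr => e e0; rewrite add0r.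
have [N _ HN] := uz (e / 2) ltac:(lra).
have -> : z - (y + cmul y z) = (z - u N.+1) + cmul y (u N - z).
  by rewrite /u iterS -/(u N) cmulBr !opprD !addrA addrNK.
rewrite (le_trans (ler_rnormD _ _))// (splitr e) lerD//.
  by apply/ltW/HN => /=.
rewrite (le_trans (rnorm_cmul _ _))//.
rewrite (@le_trans _ _ (rnorm (u N - z)))//; first by rewrite ler_piMl ?rnorm_ge0// ltW.
by rewrite rdistrC; apply/ltW/HN => /=.
Qed.

End CStarBasics.

(** If [b < a], the powers of [b / a] fall below [1 / C]. This removes a multiplicative constant
    from an estimate on all powers. *)
Lemma ler_geometric (R : realType) (C a b : R) :
  0 <= b -> (forall n, a ^+ n <= C * b ^+ n) -> a <= b.
Proof.
move=> b0 le_ab; rewrite leNgt; apply/negP => lt_ba.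
have a0 : 0 < a by exact: le_lt_trans lt_ba.
have C0 : 0 < C by rewrite (lt_le_trans ltr01)//; have := le_ab 0%N; rewrite !expr0 mulr1.
have q1 : b / a < 1 by rewrite ltr_pdivrMr ?mul1r.
have [||n] := exprn_lt_near _ q1 (e := C^-1); rewrite ?divr_ge0 ?invr_gt0 ?(ltW a0)//.
rewrite expr_div_n ltr_pdivrMr ?exprn_gt0// mulrC ltr_pdivlMr// mulrC.
by rewrite ltNge le_ab.
Qed.

Section Characters.
Variables (R : realType) (A : cstarAlgType R) (h : A -> R[i]).
Hypothesis hP : spectrum A h.
Implicit Types x y z : A.

Lemma charZD c x y : h (c *: x + y) = c * h x + h y.
Proof. by case: hP => + _ _; exact. Qed.

Lemma charM x y : h (cmul x y) = h x * h y.
Proof. by case: hP => _ + _; exact. Qed.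

Lemma char0 : h 0 = 0.
Proof.
have := charZD 1 0 0; rewrite scaler0 addr0 mul1r => /eqP.
by rewrite -subr_eq subrr eq_sym => /eqP.
Qed.

Lemma charZ c x : h (c *: x) = c * h x.
Proof. by rewrite -[c *: x]addr0 charZD char0 addr0. Qed.

Lemma charD x y : h (x + y) = h x + h y.
Proof. by rewrite -[x]scale1r charZD mul1r scale1r. Qed.

Lemma charB x y : h (x - y) = h x - h y.
Proof. by rewrite charD -scaleN1r charZ mulN1r. Qed.

Lemma char_sum (I : Type) (s : seq I) (P : pred I) (F : I -> A) :
  h (\sum_(i <- s | P i) F i) = \sum_(i <- s | P i) h (F i).
Proof. exact: (big_morph h charD char0). Qed.

(* If [|x| < |h x|] then [h] would take the value 1 at a quasi-invertible element. *)
Lemma rnorm_char x : rnorm (h x) <= rnorm x.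
Proof.
rewrite leNgt; apply/negP => lt_xh.
have hx0 : h x != 0.
  by apply: contraTneq lt_xh => ->; rewrite rnorm0 -leNgt rnorm_ge0.
have [|z zE] := @quasi_inverse R A ((h x)^-1 *: x).
  rewrite rnormZ rnormV mulrC ltr_pdivrMr ?mul1r//.
  exact: (le_lt_trans (rnorm_ge0 x) lt_xh).
have := congr1 h zE; rewrite charD charM charZ mulVf// mul1r => /eqP.
by rewrite -[X in X == _]add0r (inj_eq (addIr _)) eq_sym oner_eq0.
Qed.

(* For self-adjoint [x], multiplication by [x + it] has operator norm at most
   [sqrt (|x|^2 + t^2)], and [h] turns its n-th power into [(h x + it)^n], so that
   [|h x + it|^2 <= |x|^2 + t^2] for all real [t]. *)
Lemma char_adj x : h (adj x) = (h x)^*.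
Proof.
have sa_real y : adj y = y -> complex.Im (h y) = 0.
  move=> ya.
  have hyt (t : R) : rnorm (h y + 'i%R * t%:C) ^+ 2 <= rnorm y ^+ 2 + t ^+ 2.
    (* There may be no unit, so the powers of [L] are applied to some [w] outside the kernel of [h];
       [ler_geometric] removes the resulting constant. *)
    have [w hw] : exists w, h w <> 0 by case: hP.
    pose L z := cmul y z + ('i%R * t%:C) *: z.
    have LE z : rnorm (L z) ^+ 2 <= (rnorm y ^+ 2 + t ^+ 2) * rnorm z ^+ 2.
      rewrite -rnorm_cstar /L adjD adjZ adjM ya.
      rewrite cmulDl !cmulDr !cmulZl !cmulZr scalerA.
      have -> : Num.conj ('i%R * t%:C : R[i]) = - ('i%R * t%:C).
        by rewrite rmorphM/= conjCi conj_Creal ?mulNr// complex_real.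
      rewrite scaleNr !cmulA !addrA addrK.
      have -> : - ('i%R * t%:C) * ('i%R * t%:C) = (t ^+ 2)%:C :> R[i].
        by rewrite -complexiE; congr Complex; rewrite /=; ring.
      rewrite (le_trans (ler_rnormD _ _))// mulrDl lerD//.
        rewrite -exprMn -cmulA -{1}ya -adjM rnorm_cstar.
        by rewrite ler_pXn2r ?nnegrE ?mulr_ge0 ?rnorm_ge0// rnorm_cmul.
      by rewrite rnormZ rnorm_cstar ger0_rnorm ?sqr_ge0.
    have Lh n : h (iter n L w) = (h y + 'i%R * t%:C) ^+ n * h w.
      elim: n => [|n IH]; first by rewrite mul1r.
      by rewrite iterS {1}/L charD charM charZ IH -mulrDl exprS mulrA.
    have Ln n : rnorm (iter n L w) ^+ 2 <= (rnorm y ^+ 2 + t ^+ 2) ^+ n * rnorm w ^+ 2.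
      elim: n => [|n IH]; first by rewrite mul1r.
      rewrite iterS (le_trans (LE _))// [_ ^+ n.+1]exprS -mulrA ler_wpM2l//.
      by rewrite addr_ge0 ?sqr_ge0.
    have hw0 : 0 < rnorm (h w) ^+ 2 by rewrite exprn_gt0// rnorm_gt0//; apply/eqP.
    apply: (@ler_geometric _ (rnorm w ^+ 2 / rnorm (h w) ^+ 2)) => [|n].
      by rewrite addr_ge0 ?sqr_ge0.
    rewrite mulrAC ler_pdivlMr// -exprM mulnC exprM -[_ ^+ n]rnormX -exprMn -rnormM.
    rewrite -Lh [_ ^+ 2 * _]mulrC (le_trans _ (Ln n))//.
    by rewrite ler_pXn2r ?nnegrE ?rnorm_ge0// rnorm_char.
  apply/eqP; apply: contraT => b0.
  set a := complex.Re (h y); set b := complex.Im (h y) in b0 *.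
  (* This [t] makes the cross term [2 b t] equal to [2 (|y|^2 + 1)], which is too large for
     [hyt]. *)
  have := hyt ((rnorm y ^+ 2 + 1) / b); rewrite rnorm_sqr.
  set t := _ / b.
  have -> : complex.Re (h y + 'i%R * t%:C) = a.
    by rewrite -complexiE /a; case: (h y) => u v /=; ring.
  have -> : complex.Im (h y + 'i%R * t%:C) = b + t.
    by rewrite -complexiE /b; case: (h y) => u v /=; ring.
  have -> : (b + t) ^+ 2 = b ^+ 2 + 2 * (rnorm y ^+ 2 + 1) + t ^+ 2.
    by rewrite /t; field.
  have := sqr_ge0 a; have := sqr_ge0 b; have := sqr_ge0 (rnorm y); lra.

(* [x + adj x] and [i (x - adj x)] are self-adjoint, so [h] is real on both, and this determines
   [h (adj x)]. *)
have u0 : complex.Im (h x + h (adj x)) = 0.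
  by rewrite -charD sa_real// adjD adjK addrC.
have v0 : complex.Im ('i%R * (h x - h (adj x))) = 0.
  rewrite -charB -charZ sa_real// adjZ conjCi scaleNr -scalerN; congr (_ *: _).
  by rewrite -[- adj x]scaleN1r adjD adjZ adjK rmorphN1 !scaleN1r opprB addrC.
move: u0 v0; rewrite -complexiE; case: (h x) (h (adj x)) => a b [c d] /= u0 v0.
by congr Complex; lra.
Qed.

Lemma char_cstar x : h (cmul (adj x) x) = (rnorm (h x) ^+ 2)%:C.
Proof. by rewrite charM char_adj rmorphXn/= -rnormE sqr_normc mulrC. Qed.

End Characters.

Lemma near_rnorm (R : realType) (V : normedModType R[i]) (v : V) (r : R) :
  0 < r -> \forall w \near v, rnorm (v - w) < r.
Proof. by move=> r0; have /cvg_rnormP/(_ _ r0) : id @ nbhs v --> v by exact: cvg_id. Qed.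

Lemma rnorm_continuous (R : realType) (V : normedModType R[i]) :
  continuous (fun v : V => rnorm v).
Proof.
move=> x; apply/cvgrPdist_lt => r r0.
apply: filterS (near_rnorm x r0) => y; apply: le_lt_trans; rewrite ler_norml.
have := ler_rnormD (x - y) y; have := ler_rnormD (y - x) x.
by rewrite !subrK (rdistrC y); lra.
Qed.

Lemma ler_rnorm_ReIm (R : realType) (z : R[i]) :
  rnorm z <= `|complex.Re z| + `|complex.Im z|.
Proof.
rewrite {1}[z]complexE (le_trans (ler_rnormD _ _))// rnormM !rnorm_real.
by rewrite complexiE [rnorm 'i%R]/rnorm normCi mul1r.
Qed.

(** The disc is a closed subset of the image of the compact square [[-r, r]^2]. *)
Lemma compact_disc (R : realType) (r : R) : compact [set z : R[i]^o | rnorm z <= r].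
Proof.
pose f (u : R * R) : R[i]^o := (u.1 +i* u.2)%C.
have fc : continuous f.
  move=> [a b]; apply/cvg_rnormP => d d0.
  have d2 : 0 < d / 2 by lra.
  have nearby (c : R) : \forall x \near c, `|c - x| < d / 2.
    by apply: (@cvgr_dist_lt _ _ _ (nbhs c)) => //; exact: cvg_id.
  exists ([set x | `|a - x| < d / 2], [set y | `|b - y| < d / 2]) => /=.
    by split; exact: nearby.
  move=> [x y]/= [ax bY]; apply: le_lt_trans (ler_rnorm_ReIm _) _ => /=.
  by rewrite (splitr d) ltrD.
have dE : [set z : R[i]^o | rnorm z <= r] =
    (fun z : R[i]^o => rnorm z) @^-1` [set x | x <= r] by [].
apply: (@subclosed_compact _ _ (f @` (`[- r, r]%classic `*` `[- r, r]%classic))).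
- rewrite dE; apply: closed_comp; last exact: closed_le.
  by move=> z _; exact: rnorm_continuous.
- apply: continuous_compact; first by apply: continuous_subspaceT; exact: fc.
  by apply: compact_setX; exact: segment_compact.
- move=> [a b]/= abr; exists (a, b) => //=.
  have := rnorm_sqr (a +i* b)%C => /= E.
  have r0 : 0 <= r by exact: le_trans (rnorm_ge0 _) abr.
  have : rnorm (a +i* b)%C ^+ 2 <= r ^+ 2 by rewrite ler_pXn2r ?nnegrE ?rnorm_ge0.
  have key (c : R) : c ^+ 2 <= r ^+ 2 -> c \in `[- r, r].
    by rewrite -(real_normK (num_real c)) ler_pXn2r ?nnegrE// ler_norml in_itv.
  rewrite E => abr2; split; apply: key; apply: le_trans abr2.
    by rewrite lerDl sqr_ge0.
  by rewrite lerDr sqr_ge0.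
Qed.

(** * Gelfand theory *)

Section PowerMultiplicativeSeminorms.
Variables (R : realType) (A : cstarAlgType R).
Hypothesis cmulC : commutative (@cmul R A).
Variable e : A.
Hypothesis eP : is_unit_of e.
Implicit Types (x y z c : A) (p q : A -> R) (F : set (A -> R)).

(** Power-multiplicativity is asked for squares only; [pm_pow1] recovers the other powers. *)
Record pm_seminorm p : Prop := PmSeminorm {
  pm_le : forall y, p y <= rnorm y;
  pmD : forall y z, p (y + z) <= p y + p z;
  pmZ : forall (a : R[i]) y, p (a *: y) = rnorm a * p y;
  pmM : forall y z, p (cmul y z) <= p y * p z;
  pm_sqr : forall y, p (cmul y y) = p y ^+ 2;
  pm1 : p e = 1 }.

Lemma pm0 p : pm_seminorm p -> p 0 = 0.
Proof. by move=> pP; rewrite -(scale0r 0) pmZ// rnorm0 mul0r. Qed.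

Lemma pmN p y : pm_seminorm p -> p (- y) = p y.
Proof. by move=> pP; rewrite -scaleN1r pmZ// rnormN rnorm1 mul1r. Qed.

Lemma pm_ge0 p y : pm_seminorm p -> 0 <= p y.
Proof.
move=> pP; have := pmD pP y (- y); rewrite subrr pm0// pmN//.
by rewrite -mulr2n pmulrn_lge0.
Qed.

Lemma ler_pmB p y z : pm_seminorm p -> p y <= p (y - z) + p z.
Proof. by move=> pP; have := pmD pP (y - z) z; rewrite subrK. Qed.

Section Infimum.
Variable F : set (A -> R).
Hypothesis F0 : F !=set0.
Hypothesis F_ge0 : forall p y, F p -> 0 <= p y.

Definition inf_fam y : R := inf [set p y | p in F].

Lemma inf_fam_le p y : F p -> inf_fam y <= p y.
Proof.
move=> Fp; apply: ge_inf; last by exists p.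
by exists 0 => _ [q Fq <-]; exact: F_ge0.
Qed.

(** The affine form in [p y] lets an inequality involving two values pass to the infimum one value
    at a time. *)
Lemma le_inf_fam (K k k' : R) y : 0 <= k ->
  (forall p, F p -> K <= k * p y + k') -> K <= k * inf_fam y + k'.
Proof.
have [p0 Fp0] := F0.
rewrite le_eqVlt => /orP[/eqP <- KF|k0 KF].
  by have := KF _ Fp0; rewrite !mul0r.
rewrite -lerBlDr -ler_pdivrMl//; apply: lb_le_inf; first by exists (p0 y), p0.
by move=> _ [p Fp <-]; rewrite ler_pdivrMl// lerBlDr KF.
Qed.

(** The two bounds may use different members of [F], so the infimum can be homogeneous when no
    member is. *)
Lemma inf_fam_homog (k : R) x y : 0 <= k ->
  (forall p, F p -> exists2 q, F q & k * q y <= p (cmul x y)) ->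
  (forall p, F p -> exists2 q, F q & q (cmul x y) <= k * p y) ->
  inf_fam (cmul x y) = k * inf_fam y.
Proof.
move=> k0 Fge Fle; apply/eqP; rewrite eq_le; apply/andP; split.
  rewrite -[leRHS]addr0; apply: le_inf_fam => // p /Fle[q Fq le_q].
  by rewrite addr0 (le_trans _ le_q)// inf_fam_le.
rewrite -[leRHS]mul1r -[leRHS]addr0; apply: le_inf_fam => // p /Fge[q Fq le_q].
by rewrite mul1r addr0 (le_trans _ le_q)// ler_wpM2l// inf_fam_le.
Qed.

Hypothesis F_le : forall p y, F p -> p y <= rnorm y.
Hypothesis FD : forall p y z, F p -> p (y + z) <= p y + p z.
Hypothesis FZ : forall p (a : R[i]) y, F p -> p (a *: y) = rnorm a * p y.
Hypothesis F1 : forall p, F p -> p e = 1.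
Hypothesis F_directed : forall p q, F p -> F q ->
  exists2 r, F r & forall y, r y <= p y /\ r y <= q y.
Hypothesis FM : forall p, F p ->
  exists2 q, F q & forall y z, q (cmul y z) <= p y * p z.
Hypothesis F_sqr : forall p, F p ->
  exists2 q, F q & forall y, q y ^+ 2 <= p (cmul y y).

(** Products and squares may be controlled by another member of [F], since the infimum absorbs the
    change. Directedness puts two members above a common one. *)
Lemma pm_inf_fam : pm_seminorm inf_fam.
Proof.
have [p0 Fp0] := F0.
have inf_ge0 y : 0 <= inf_fam y.
  rewrite -[leRHS]mul1r -[leRHS]addr0; apply: le_inf_fam => // p Fp.
  by rewrite mul1r addr0 F_ge0.
have infM y z : inf_fam (cmul y z) <= inf_fam y * inf_fam z.
  rewrite -[leRHS]addr0; apply: le_inf_fam => // p Fp; rewrite addr0 mulrC.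
  rewrite -[leRHS]addr0; apply: le_inf_fam => [|q Fq]; first exact: F_ge0.
  have [r Fr rpq] := F_directed Fp Fq; have [s Fs sr] := FM Fr.
  rewrite addr0 (le_trans (inf_fam_le _ Fs))// (le_trans (sr _ _))// mulrC.
  by have [? _] := rpq z; have [_ ?] := rpq y; rewrite ler_pM// F_ge0.
split => //.
- by move=> y; rewrite (le_trans (inf_fam_le _ Fp0))// F_le.
- move=> y z; rewrite [leRHS]addrC -[inf_fam z]mul1r; apply: le_inf_fam => // p Fp.
  rewrite mul1r [leRHS]addrC -[inf_fam y]mul1r; apply: le_inf_fam => // q Fq.
  have [r Fr rpq] := F_directed Fp Fq.
  have [? _] := rpq z; have [_ ?] := rpq y.
  by rewrite mul1r (le_trans (inf_fam_le _ Fr))// (le_trans (FD _ _ Fr))// lerD.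
- move=> a y; apply/eqP; rewrite eq_le; apply/andP; split.
    rewrite -[leRHS]addr0; apply: le_inf_fam => [|p Fp]; first exact: rnorm_ge0.
    by rewrite addr0 -FZ// inf_fam_le.
  rewrite -[leRHS]mul1r -[leRHS]addr0; apply: le_inf_fam => // p Fp.
  by rewrite mul1r addr0 FZ// ler_wpM2l ?rnorm_ge0// inf_fam_le.
- move=> y; apply/eqP; rewrite eq_le {1}expr2 infM/=.
  rewrite -[leRHS]mul1r -[leRHS]addr0; apply: le_inf_fam => // p /F_sqr[q Fq qp].
  rewrite mul1r addr0 (le_trans _ (qp y))//.
  by rewrite ler_pXn2r ?nnegrE ?inf_ge0 ?F_ge0// inf_fam_le.
- apply/eqP; rewrite eq_le; apply/andP; split; first by rewrite -(F1 Fp0) inf_fam_le.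
  rewrite -[leRHS]mul1r -[leRHS]addr0; apply: le_inf_fam => // p Fp.
  by rewrite mul1r addr0 F1.
Qed.

End Infimum.

Lemma pm_pow p c n y : pm_seminorm p ->
  p (iter n (cmul c) y) <= p c ^+ n * p y.
Proof.
move=> pP; elim: n => [|n IH]; first by rewrite mul1r.
rewrite iterS (le_trans (pmM pP _ _))// [_ ^+ n.+1]exprS -mulrA.
by rewrite ler_wpM2l// pm_ge0.
Qed.

Lemma iter_cmulM c n m y z :
  cmul (iter n (cmul c) y) (iter m (cmul c) z) = iter (n + m) (cmul c) (cmul y z).
Proof.
elim: n => [|n IH]; last by rewrite iterS -cmulA IH addSn iterS.
rewrite add0n /=; elim: m => [//|m IH].
by rewrite iterS cmulA (cmulC y) -cmulA IH.
Qed.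

Lemma iter_cmulD c n y z :
  iter n (cmul c) (y + z) = iter n (cmul c) y + iter n (cmul c) z.
Proof. by elim: n => [//|n IH]; rewrite !iterS IH cmulDr. Qed.

Lemma iter_cmulZ c n (a : R[i]) y :
  iter n (cmul c) (a *: y) = a *: iter n (cmul c) y.
Proof. by elim: n => [//|n IH]; rewrite !iterS IH cmulZr. Qed.

Lemma iter_cmulx c n x y :
  iter n (cmul c) (cmul x y) = cmul x (iter n (cmul c) y).
Proof.
by elim: n => [//|n IH]; rewrite !iterS IH !cmulA (cmulC x).
Qed.

(** Repeated squaring settles the exponents [2^k]. For general [n], put [m = 2^n - n]: then
    [p c ^ (2^n) <= p c ^ m * p (c^n)], and [p c ^ m] cancels. *)
Lemma pm_pow1 p c n : pm_seminorm p -> 0 < p c -> p (iter n (cmul c) e) = p c ^+ n.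
Proof.
move=> pP c0; have p2 k : p (iter (2 ^ k) (cmul c) e) = p c ^+ (2 ^ k).
  elim: k => [|k IH]; first by rewrite /= (eP c).2.
  by rewrite expnS mul2n -addnn -{1}(eP e).1 -iter_cmulM pm_sqr// IH expr2 exprD.
apply/eqP; rewrite eq_le; apply/andP; split.
  by rewrite (le_trans (pm_pow _ _ _ pP))// pm1// mulr1.
have mn : (2 ^ n - n + n = 2 ^ n)%N by rewrite subnK// ltnW// ltn_expl.
move: (2 ^ n - n)%N mn => m mn.
by rewrite -(ler_pM2l (exprn_gt0 m c0)) -exprD mn -p2 -mn iterD pm_pow.
Qed.

End PowerMultiplicativeSeminorms.

Section Gelfand.
Variables (R : realType) (A : cstarAlgType R).
Hypothesis cmulC : commutative (@cmul R A).
Variable e : A.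
Hypothesis eP : is_unit_of e.
Implicit Types (x y z c : A) (p q : A -> R) (F : set (A -> R)).

(** By commutativity [adj (y y) (y y)] equals [adj v v] for [v = adj y y], so the norm identity
    applies to [y y], to [v] and to [y]. *)
Lemma rnorm_sqr_cmul y : rnorm (cmul y y) = rnorm y ^+ 2.
Proof.
apply/eqP; rewrite -(@eqrXn2 _ 2)// ?rnorm_ge0 ?sqr_ge0//; apply/eqP.
rewrite -(rnorm_cstar (cmul y y)) adjM.
have -> : cmul (cmul (adj y) (adj y)) (cmul y y) =
    cmul (adj (cmul (adj y) y)) (cmul (adj y) y).
  by rewrite adjM adjK !cmulA; congr cmul; rewrite -!cmulA; congr cmul; exact: cmulC.
by rewrite !rnorm_cstar.
Qed.

Lemma pm_rnorm : e != 0 -> pm_seminorm e (@rnorm R A).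
Proof.
move=> e0; split => //; [exact: ler_rnormD|exact: rnormZ|exact: rnorm_cmul| |].
  exact: rnorm_sqr_cmul.
have ne0 : rnorm e != 0 by rewrite gt_eqF// rnorm_gt0.
have := rnorm_sqr_cmul e; rewrite (eP e).1 expr2 => /esym/eqP.
by rewrite -[X in _ == X]mulr1 (inj_eq (mulfI ne0)) => /eqP.
Qed.

(* The infimum of the nonincreasing sequence [p (c^n y) / p c ^ n]. *)
Lemma pm_smoothing p c : pm_seminorm e p -> 0 < p c -> exists q,
  [/\ pm_seminorm e q, forall y, q y <= p y, forall y, q (cmul c y) = p c * q y
    & forall x (k : R), 0 <= k -> (forall y, p (cmul x y) = k * p y) ->
      forall y, q (cmul x y) = k * q y].
Proof.
move=> pP c0; pose u n y := p (iter n (cmul c) y) / p c ^+ n.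
have c0n n : 0 < p c ^+ n by exact: exprn_gt0.
have ci n : 0 <= (p c ^+ n)^-1 by rewrite invr_ge0 ltW.
have u_ge0 n y : 0 <= u n y by rewrite divr_ge0 ?(pm_ge0 _ pP)// ltW.
have u_mono n k y : u (k + n)%N y <= u n y.
  rewrite /u ler_pdivrMr// iterD (le_trans (pm_pow _ _ _ pP))// exprD mulrCA.
  by rewrite -!mulrA mulVf ?gt_eqF// mulr1.
pose F : set (A -> R) := range u.
have F0 : F !=set0 by exists (u 0%N), 0%N.
have F_ge0 p0 y : F p0 -> 0 <= p0 y by move=> [n _ <-].
have u0 y : u 0%N y = p y by rewrite /u/= divr1.
have qP : pm_seminorm e (inf_fam F).
  apply: pm_inf_fam => //.
  - move=> _ y [n _ <-]; rewrite -[n]addn0 (le_trans (u_mono 0%N n y))// u0.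
    exact: pm_le pP _.
  - move=> _ y z [n _ <-]; rewrite /u iter_cmulD -mulrDl ler_wpM2r//.
    exact: pmD pP _ _.
  - by move=> _ a y [n _ <-]; rewrite /u iter_cmulZ (pmZ pP) mulrA.
  - by move=> _ [n _ <-]; rewrite /u (pm_pow1 _ eP)// divff// gt_eqF.
  - move=> _ _ [n _ <-] [m _ <-]; exists (u (n + m)%N); first by exists (n + m)%N.
    by move=> y; split; [rewrite addnC|]; exact: u_mono.
  - move=> _ [n _ <-]; exists (u (n + n)%N); first by exists (n + n)%N.
    move=> y z; rewrite /u mulf_div -exprD -iter_cmulM//.
    by rewrite ler_wpM2r// (pmM pP).
  - move=> _ [n _ <-]; exists (u n); first by exists n.
    move=> y; rewrite (le_trans _ (u_mono n n _))//.
    by rewrite /u expr2 mulf_div -exprD -expr2 -(pm_sqr pP) -iter_cmulM.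
exists (inf_fam F); split=> //.
- by move=> y; rewrite -u0; apply: inf_fam_le => //; exists 0%N.
(* [u n (c y) = p c * u (n + 1) y]: up to the factor, multiplication by [c] shifts the nonincreasing
   sequence, which leaves its infimum unchanged. *)
- move=> y; apply: inf_fam_homog => //; first exact: ltW.
    move=> _ [n _ <-]; exists (u n.+1); first by exists n.+1.
    by rewrite /u iterSr exprS invfM mulrCA mulVKf ?gt_eqF//.
  move=> _ [n _ <-]; exists (u n); first by exists n.
  rewrite /u iter_cmulx// mulrA ler_wpM2r//.
  exact: pmM pP _ _.
- move=> x k k0 xk y; apply: inf_fam_homog => // _ [n _ <-];
    exists (u n); [by exists n| |by exists n|];
    by rewrite /u iter_cmulx// xk mulrA.
Qed.

Lemma multiplicative_seminorm x : x != 0 -> exists p,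
  [/\ pm_seminorm e p, forall y z, p (cmul y z) = p y * p z & p x = rnorm x].
Proof.
move=> x0; have e0 : e != 0.
  by apply: contraNneq x0 => e0; rewrite -(eP x).1 e0 cmul0l.
pose fam p := pm_seminorm e p /\ forall y, p (cmul x y) = rnorm x * p y.
have [p0 [p0P _ p0x _]] := pm_smoothing (pm_rnorm e0) (rnorm_gt0 x0).
have fam0 : fam p0 by [].
(* The order is reversed, so that the maximal element given by Zorn's lemma is a minimal
   seminorm. *)
pose T := {p | fam p}; pose r (s t : T) := `[< forall y, sval t y <= sval s y >].
have [||||t tmin] := @Zorn T r.
- by move=> t; apply/asboolP.
- move=> s t u /asboolP st /asboolP tu; apply/asboolP => y.
  exact: le_trans (tu y) (st y).
- move=> [s sP] [t tP] /asboolP/= st /asboolP/= ts.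
  have E : s = t by apply/funext => y; apply/eqP; rewrite eq_le ts st.
  by subst s; congr exist; exact: Prop_irrelevance.
- move=> C Ctot; have [[t0 Ct0]|C0] := pselect (C !=set0); last first.
    by exists (exist _ _ fam0) => s Cs; exfalso; apply: C0; exists s.
  pose F : set (A -> R) := [set sval t | t in C].
  have F0 : F !=set0 by exists (sval t0), t0.
  have FP p : F p -> pm_seminorm e p by move=> [[q [qP qx]] _ <-].
  have Fx p : F p -> forall y, p (cmul x y) = rnorm x * p y.
    by move=> [[q [qP qx]] _ <-].
  have F_ge0 p y : F p -> 0 <= p y by move=> /FP/pm_ge0.
  have qP : pm_seminorm e (inf_fam F).
    apply: pm_inf_fam => //.
    - by move=> p y /FP/pm_le.
    - by move=> p y z /FP/pmD.
    - by move=> p a y /FP/pmZ.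
    - by move=> p /FP/pm1.
    - move=> _ _ [s Cs <-] [t Ct <-].
      by have [/asboolP st|/asboolP st] := Ctot s t Cs Ct;
        [exists (sval t); first by exists t|exists (sval s); first by exists s].
    - by move=> p Fp; exists p => // y z; exact: pmM (FP _ Fp) _ _.
    - by move=> p Fp; exists p => // y; rewrite (pm_sqr (FP _ Fp)).
  have qx y : inf_fam F (cmul x y) = rnorm x * inf_fam F y.
    apply: inf_fam_homog; rewrite ?rnorm_ge0// => p Fp; exists p => //;
      by rewrite Fx.
  exists (exist _ (inf_fam F) (conj qP qx)) => s Cs; apply/asboolP => y /=.
  by apply: inf_fam_le => //; exists s.
case: t tmin => p [pP px] tmin; exists p; split => //; last first.
  by rewrite -[x in LHS](eP x).2 px (pm1 pP) mulr1.
move=> c y; have [c0|] := boolP (0 < p c); last first.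
  rewrite -leNgt le_eqVlt ltNge (pm_ge0 _ pP) orbF => /eqP c0.
  apply/eqP; rewrite eq_le (pmM pP)/= c0 mul0r.
  exact: pm_ge0 pP.
(* Smoothing at [c] stays in [fam] and goes below [p]; by minimality it returns [p], which is
   therefore homogeneous for [c]. *)
have [q [qP qp qc qx]] := pm_smoothing pP c0.
have qf : fam q by split => //; apply: qx => //; exact: rnorm_ge0.
have E : q = p by have := tmin (exist _ q qf); rewrite /r/= => /(_ (asboolT qp)) [].
by move: qc; rewrite E.
Qed.

End Gelfand.

(** * From multiplicative seminorms to characters *)

Section GelfandMazur.
Variables (R : realType) (A : cstarAlgType R).
Variable e : A.
Hypothesis eP : is_unit_of e.
Implicit Types (x y z : A).

Lemma cmul_sqrB y (s : R[i]) :
  cmul (y - s *: e) (y - (- s) *: e) = cmul y y - (s ^+ 2) *: e.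
Proof.
rewrite scaleNr opprK cmulDr cmulZr (eP _).2 cmulBl cmulZl (eP _).1.
by rewrite scalerBr scalerA -expr2 addrA addrNK.
Qed.

Variable p : A -> R.
Hypothesis pP : pm_seminorm e p.
Hypothesis pMul : forall y z, p (cmul y z) = p y * p z.

Lemma pm_char_dist y (l m : R[i]) : `|p (y - l *: e) - p (y - m *: e)| <= rnorm (l - m).
Proof.
have dist (a b : R[i]) : p (y - a *: e) <= p (y - b *: e) + rnorm (a - b).
  have -> : y - a *: e = (y - b *: e) + (b - a) *: e.
    by rewrite scalerBl addrA addrNK.
  by rewrite (le_trans (pmD pP _ _))// lerD2l (pmZ pP) (pm1 pP) mulr1 rdistrC.
by rewrite ler_norml; have := dist l m; have := dist m l; rewrite (rdistrC m); lra.
Qed.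

(* Mazur's argument: if [m = min_l p (y - l e)] were positive, then for [|u| < m] the
   factorization of [y^N - u^N], N = 2^k, gives
   [p (y - u) m^(N-1) <= m^N + |u|^N], so that the set of minimizers is open, hence
   unbounded. *)
Lemma pm_eigen y : exists l : R[i], p (y - l *: e) = 0.
Proof.
pose f (l : R[i]^o) := p (y - l *: e).
have fc : continuous f.
  move=> l; apply: (cvgrPdist_lt (F := nbhs (l : R[i]^o)) f (f l)).2 => r r0.
  have := @near_rnorm R R[i]^o l r r0.
  apply: (@filterS _ (nbhs (l : R[i]^o)) (nbhs_filter _)) => t; apply: le_lt_trans.
  exact: pm_char_dist.
have f0 : f 0 = p y by rewrite /f scale0r subr0.
have f_ge l : rnorm l - p y <= f l.
  rewrite lerBlDr addrC.
  have := ler_pmB (l *: e) y pP; rewrite (pmZ pP) (pm1 pP) mulr1 => /le_trans; apply.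
  by rewrite addrC -opprB (pmN _ pP).
have py0 : 0 <= p y by exact: pm_ge0 pP.
(* Outside the disc of radius [2 p y], [f l >= |l| - p y > p y = f 0], so a minimum over the disc is
   a global one. *)
have [||l0 _ l0min] := @compact_EVT_min _ _ f _ _ (@compact_disc R (2 * p y)).
- by exists 0; rewrite /= rnorm0; lra.
- exact: continuous_subspaceT.
set m := f l0 in l0min.
have fm l : m <= f l.
  have [l1|l1] := leP (rnorm l) (2 * p y); first by apply: l0min; rewrite inE.
  have : m <= f 0 by apply: l0min; rewrite inE /= rnorm0; lra.
  by have := f_ge l; rewrite f0; lra.
exists l0; rewrite -/(f l0) -/m; apply/eqP; apply: contraT => m_neq0.
have m0 : 0 < m by rewrite lt_neqAle eq_sym m_neq0 (pm_ge0 _ pP).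
have step l u : f l = m -> rnorm u <= m / 2 -> f (l + u) = m.
  move=> flm um; pose w := y - l *: e; pose sq z := cmul z z.
  have wf v : p (w - v *: e) = f (l + v) by rewrite /f scalerDl opprD addrA.
  (* Square roots of [v] split [w^(2^k) - v] into [2^k] factors of the form [w - v'], each of
     seminorm at least [m]. *)
  have lowB k v : m ^+ (2 ^ k) <= p (iter k sq w - v *: e).
    elim: k v => [v|k IH v]; first by rewrite expr1 wf.
    rewrite iterS -[v]sqrtCK -cmul_sqrB pMul expnS mul2n -addnn exprD.
    by rewrite ler_pM// exprn_ge0// ltW.
  (* The factor [w - u] is kept and the remaining ones are bounded below by [lowB]; the extra [m] on
     the right avoids the exponent [2^k - 1]. *)
  have upB k : p (w - u *: e) * m ^+ (2 ^ k) <=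
      p (iter k sq w - (u ^+ (2 ^ k)) *: e) * m.
    elim: k => [|k IH]; first by rewrite !expr1.
    rewrite iterS expnS mulnC !(exprM _ (2 ^ k)) -cmul_sqrB pMul expr2 mulrA.
    rewrite [leRHS]mulrAC (le_trans (ler_wpM2r _ IH)) ?exprn_ge0 ?(ltW m0)//.
    by rewrite ler_wpM2l ?mulr_ge0 ?(pm_ge0 _ pP) ?(ltW m0).
  have sqp k : p (iter k sq w) = m ^+ (2 ^ k).
    elim: k => [|k IH]; first by rewrite expr1 -flm.
    by rewrite iterS (pm_sqr pP) IH -exprM mulnC expnS.
  have bound k : p (w - u *: e) <= m + m * (2^-1) ^+ (2 ^ k).
    have mN : 0 < m ^+ (2 ^ k) by exact: exprn_gt0.
    rewrite -(ler_pM2r mN) (le_trans (upB k))//.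
    have -> : (m + m * 2^-1 ^+ (2 ^ k)) * m ^+ (2 ^ k) =
        (m ^+ (2 ^ k) + 2^-1 ^+ (2 ^ k) * m ^+ (2 ^ k)) * m by ring.
    rewrite ler_wpM2r ?(ltW m0)// (le_trans (pmD pP _ _))// sqp lerD2l.
    rewrite (pmN _ pP) (pmZ pP) (pm1 pP) mulr1 rnormX -exprMn mulrC.
    by rewrite ler_pXn2r ?expn_gt0 ?nnegrE ?rnorm_ge0 ?divr_ge0 ?(ltW m0)//.
  apply/eqP; rewrite eq_le fm andbT -wf; apply/ler_addgt0Pr => d d0.
  have [|||n nd] := @exprn_lt_near R 2^-1 (d / m); [lra|lra|exact: divr_gt0|].
  rewrite (le_trans (bound n))// lerD2l mulrC -ler_pdivlMr// (le_trans _ (ltW nd))//.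
  by rewrite ler_wiXn2l ?invr_ge0 ?invf_le1 ?ler1n// ltnW// ltn_expl.
(* Steps of length [m / 2] keep [f] equal to [m] arbitrarily far out, against [f_ge]. *)
have far n : f (l0 + (n%:R * (m / 2))%:C) = m.
  elim: n => [|n IH]; first by rewrite mul0r addr0.
  rewrite -natr1 mulrDl mul1r rmorphD addrA/= step//.
  by rewrite ger0_rnorm// divr_ge0// ltW.
set B := (m + p y + rnorm (l0 : R[i])) / (m / 2).
have B0 : 0 <= B by rewrite divr_ge0 ?addr_ge0 ?rnorm_ge0 ?(ltW m0)// divr_ge0// ltW.
have := archi_boundP B0; set n := Num.bound B; rewrite ltr_pdivrMr; last by rewrite divr_gt0.
have := f_ge (l0 + (n%:R * (m / 2))%:C); rewrite far.
have c0 : 0 <= n%:R * (m / 2) by rewrite mulr_ge0 ?ler0n// divr_ge0// ltW.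
have := ler_rnormB (l0 + (n%:R * (m / 2))%:C : R[i]) l0.
by rewrite [_ - l0]addrC addKr (ger0_rnorm c0); lra.
Qed.

(** [h y] is the scalar with [p (y - h y e) = 0]. It is unique because [p e = 1], and uniqueness
    makes [h] linear and multiplicative. *)
Lemma pm_char : exists2 h : A -> R[i], spectrum A h & forall y, rnorm (h y) = p y.
Proof.
pose h y := sval (cid (pm_eigen y)).
have hE y : p (y - h y *: e) = 0 by rewrite /h; case: cid.
have uniq y l : p (y - l *: e) = 0 -> h y = l.
  move=> yl; apply/eqP; rewrite -subr_eq0; apply/eqP/rnorm0_eq0/eqP.
  rewrite eq_le rnorm_ge0 andbT -[rnorm _]mulr1 -(pm1 pP) -(pmZ pP).
  have -> : (h y - l) *: e = (y - l *: e) - (y - h y *: e).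
    by rewrite scalerBl opprB [RHS]addrC addrA addrNK.
  by rewrite (le_trans (pmD pP _ _))// (pmN _ pP) hE yl addr0.
have uniq_le y l : p (y - l *: e) <= 0 -> h y = l.
  by move=> yl; apply: uniq; apply/eqP; rewrite eq_le yl (pm_ge0 _ pP).
have h1 : h e = 1 by apply: uniq; rewrite scale1r subrr (pm0 pP).
exists h => [|y]; last first.
  apply/eqP; rewrite eq_le; apply/andP; split.
    have := ler_pmB (h y *: e) y pP; rewrite (pmZ pP) (pm1 pP) mulr1.
    by rewrite -(pmN _ pP) opprB hE add0r.
  by have := ler_pmB y (h y *: e) pP; rewrite hE add0r (pmZ pP) (pm1 pP) mulr1.
split; [move=> c y z|move=> y z|]; last by exists e; rewrite h1; exact/eqP/oner_neq0.
- apply: uniq_le.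
  have -> : c *: y + z - (c * h y + h z) *: e = c *: (y - h y *: e) + (z - h z *: e).
    by rewrite scalerDl scalerBr scalerA opprD addrACA.
  by rewrite (le_trans (pmD pP _ _))// (pmZ pP) !hE mulr0 addr0.
- apply: uniq_le.
  have -> : cmul y z - (h y * h z) *: e =
      cmul (y - h y *: e) z + h y *: (z - h z *: e).
    by rewrite cmulBl cmulZl (eP z).1 scalerBr scalerA addrA subrK.
  by rewrite (le_trans (pmD pP _ _))// pMul (pmZ pP) !hE mul0r mulr0 addr0.
Qed.

End GelfandMazur.

Section UnitalSpectrum.
Variables (R : realType) (A : cstarAlgType R).
Hypothesis cmulC : commutative (@cmul R A).
Variable e : A.
Hypothesis eP : is_unit_of e.
Implicit Types (x y z : A).

Lemma gelfand x : x != 0 -> exists2 h, spectrum A h & rnorm (h x : R[i]) = rnorm x.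
Proof.
move=> /(multiplicative_seminorm cmulC eP)[p [pP pM px]].
by have [h hP hp] := pm_char eP pP pM; exists h => //; rewrite hp.
Qed.

Lemma rnorm_le_char x (C : R) : 0 <= C ->
  (forall h : A -> R[i], spectrum A h -> rnorm (h x) <= C) -> rnorm x <= C.
Proof.
move=> C0 hC; have [->|/gelfand[h /hC + <-//]] := eqVneq x 0.
by rewrite rnorm0.
Qed.

Lemma char1 (h : A -> R[i]) : spectrum A h -> h e = 1.
Proof.
move=> hP; have [_ _ [x /eqP hx]] := hP.
by apply: (mulIf hx); rewrite -(charM hP) (eP x).1 mul1r.
Qed.

End UnitalSpectrum.

(** * Compactness in the weak-* topology *)

Section SpectrumTopology.
Variables (R : realType) (A : cstarAlgType R).
Implicit Types (x y z : A).

Let X := {ptws A -> R[i]^o}.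

Lemma eval_continuous x : continuous (fun h : X => h x).
Proof. exact: (@proj_continuous A (fun _ => R[i]^o) x). Qed.

(** Every [h] in [K] exceeds 1 in modulus at some element, and so do nearby characters. By
    compactness a finite set [D] serves all of [K], and [h] maps the sum of [adj x x] over [D] to a
    sum of squares, one of them above 1. *)
Lemma compact_spectrum_separated (K : set X) : compact K -> K `<=` spectrum A ->
  exists f : A, forall h, K h -> 1 <= rnorm (h f : R[i]).
Proof.
move=> /compact_near_coveringP Kc KA.
have [D0 _ KD] : \forall D \near totally,
    K `<=` (fun h : X => exists2 x, x \in (D : {fset A}) & 1 < rnorm (h x)).
  apply: (Kc _ totally (fun D (h : X) => exists2 x, x \in (D : {fset A}) & 1 < rnorm (h x)));
    first exact: (@filter_filter _ _ totally_filter).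
  move=> h Kh; have hP := KA _ Kh; have [_ _ [x /eqP hx]] := hP.
  pose y := (2 / h x) *: x.
  exists ([set h' : X | 1 < rnorm (h' y)], [set D | [fset y]%fset `<=` D]%fset) => /=.
    split; last by exists [fset y]%fset.
    apply: (@open_nbhs_nbhs _ h); split.
      apply: (@open_comp _ _ (fun h : X => rnorm (h y)) [set r : R | 1 < r]).
        move=> k _; apply: continuous_comp; first exact: eval_continuous.
        exact: rnorm_continuous.
      exact: open_gt.
    rewrite /= (charZ hP) divfK// -(rmorph_nat (real_complex R) 2).
    by rewrite ger0_rnorm ?ler0n ?ltr1n.
  by move=> [h' D]/= [h'y /fsubsetP yD]; exists y => //; apply: yD; rewrite inE.
have {}KD := KD D0 (fsubset_refl _); set D := D0 in KD.
exists (\sum_(x <- D) cmul (adj x) x) => h Kh; have hP := KA _ Kh.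
have [x xD /= hx] := KD _ Kh.
rewrite (char_sum hP); under eq_bigr do rewrite (char_cstar hP).
rewrite -rmorph_sum/= ger0_rnorm; last by apply: sumr_ge0 => z _; exact: sqr_ge0.
rewrite (big_fsetD1 x)//= (le_trans (_ : 1 <= rnorm (h x) ^+ 2))//.
  by rewrite exprn_ege1// ltW.
by rewrite lerDl sumr_ge0// => z _; exact: sqr_ge0.
Qed.

Variable e : A.
Hypothesis eP : is_unit_of e.

(** The spectrum lies in the product of the discs of radius [|x|], compact by Tychonoff. The unit
    makes it closed: the condition of being nonzero becomes [h e = 1]. *)
Lemma spectrum_compact : compact (spectrum A : set X).
Proof.
have ballc := tychonoff (fun x : A => @compact_disc R (rnorm x)).
apply: subclosed_compact ballc _; last by move=> h hP x; exact: rnorm_char hP x.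
have closed_eq (F : X -> R[i]^o) (a : R[i]^o) : continuous F -> closed (F @^-1` [set a]).
  move=> Fc; apply: closed_comp; first by move=> h _; exact: Fc.
  exact/accessible_closed_set1/hausdorff_accessible/norm_hausdorff.
have -> : (spectrum A : set X) =
    (\bigcap_(u in [set: R[i] * A * A])
       (fun h : X => h (u.1.1 *: u.1.2 + u.2) - (u.1.1 *: h u.1.2 + h u.2)) @^-1` [set 0])
    `&` (\bigcap_(u in [set: A * A])
       (fun h : X => h (cmul u.1 u.2) - h u.1 * h u.2) @^-1` [set 0])
    `&` ((fun h : X => h e) @^-1` [set (1 : R[i]^o)]).
  apply/seteqP; split => [h hP|h [[hl hm] h1]].
    split; [split|] => [u _|u _|] /=.
    - by rewrite (charZD hP) subrr.
    - by rewrite (charM hP) subrr.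
    - exact: (char1 eP hP).
  split.
  - move=> c x y; apply/eqP; rewrite -subr_eq0; apply/eqP.
    exact: (hl (c, x, y)).
  - by move=> x y; apply/eqP; rewrite -subr_eq0; apply/eqP; exact: (hm (x, y)).
  - by exists e; rewrite h1; exact/eqP/oner_neq0.
apply: closedI; [apply: closedI|]; [apply: closed_bigI => u _|apply: closed_bigI => u _|];
  apply: closed_eq => h.
- have ev x : (fun k : X => (k x : R[i]^o)) @ h --> (h x : R[i]^o) by exact: eval_continuous.
  exact: (cvgB (ev _) (cvgD (cvgZr (ev _)) (ev _))).
- have ev x : (fun k : X => (k x : R[i]^o)) @ h --> (h x : R[i]^o) by exact: eval_continuous.
  exact: (cvgB (ev _) (@cvgM R[i] _ _ _ _ _ _ _ (ev _) (ev _))).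
- exact: eval_continuous.
Qed.

End SpectrumTopology.

(** * The space of square-summable sequences *)

Section SummableSequences.
Variables (R : realType) (A : cstarAlgType R).
Implicit Types (a v w : int -> A) (F G : {fset int}).

Let totallyP := @totally_filter int.
#[local] Existing Instance totallyP.

Lemma partial_sumE a F : partial_sum a F = \sum_(j <- F) a j.
Proof. by rewrite /partial_sum big_seq_fsetE. Qed.

(** An upper bound on the l^1 norm, phrased by finite sums so that no convergence has to be
    established first. *)
Definition l1_bound a (B : R) := forall F, \sum_(j <- F) rnorm (a j) <= B.

Lemma l1_bound_ge0 a B : l1_bound a B -> 0 <= B.
Proof. by move=> /(_ fset0); rewrite big_seq_fset0. Qed.

Lemma l1_bound_coord a B j : l1_bound a B -> rnorm (a j) <= B.
Proof. by move=> /(_ [fset j]%fset); rewrite big_seq_fset1. Qed.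

Lemma l1_boundD a v B C : l1_bound a B -> l1_bound v C ->
  l1_bound (fun j => a j + v j) (B + C).
Proof.
move=> aB vC F; apply: le_trans (lerD (aB F) (vC F)).
by rewrite -big_split/=; apply: ler_sum => j _; exact: ler_rnormD.
Qed.

Lemma l1_bound_le a v B : l1_bound a B ->
  (forall j, rnorm (v j) <= rnorm (a j)) -> l1_bound v B.
Proof. by move=> aB va F; apply: le_trans (aB F); apply: ler_sum => j _. Qed.

Lemma ler_sum_fset (f : int -> R) F G : (forall j, 0 <= f j) -> (F `<=` G)%fset ->
  \sum_(j <- F) f j <= \sum_(j <- G) f j.
Proof.
move=> f0 FG; rewrite [leRHS](big_fsetID _ (mem F) G)/=.
have -> : [fset x in G | x \in F]%fset = F.
  apply/fsetP => x; rewrite !inE /=; apply/andP/idP => [[]//|xF].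
  by split=> //; exact: (fsubsetP FG).
by rewrite lerDl sumr_ge0.
Qed.

Lemma l1_bound_fsupp a F : (forall j, j \notin F -> a j = 0) ->
  l1_bound a (\sum_(j <- F) rnorm (a j)).
Proof.
move=> aF G; rewrite (le_trans (ler_sum_fset (fun j => rnorm_ge0 (a j)) (fsubsetUl G F)))//.
rewrite -(big_fset_incl _ (fsubsetUr G F))// => j _ /aF ->.
exact: rnorm0.
Qed.

Lemma rnorm_cvg_le (T : Type) (Q : set_system T) {FQ : ProperFilter Q}
    (f : T -> A) (l : A) (B : R) :
  f @ Q --> l -> (forall t, rnorm (f t) <= B) -> rnorm l <= B.
Proof.
move=> /cvg_rnormP fl fB; apply/ler_addgt0Pr => e e0.
have [t /ltW lt] := filter_ex (fl e e0).
by have := ler_rnormD (l - f t) (f t); rewrite subrK; have := fB t; lra.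
Qed.

(** A finite set whose sum of norms comes within [e] of the supremum leaves less than [e] outside,
    so the partial sums are Cauchy. *)
Lemma l1_bound_cvg w B : l1_bound w B ->
  exists2 s, partial_sum w @ totally --> s & rnorm s <= B.
Proof.
move=> wB; suff /cvg_ex[s ws] : cvg (partial_sum w @ totally).
  exists s => //; apply: (rnorm_cvg_le ws) => F; rewrite partial_sumE.
  exact: le_trans (ler_rnorm_sum _ _ _) (wB F).
apply: rcauchy_cvg => e e0.
pose S : set R := [set \sum_(j <- F) rnorm (w j) | F in [set: {fset int}]].
have Ssup : has_sup S.
  split; first by exists (\sum_(j <- (fset0 : {fset int})) rnorm (w j)), fset0.
  by exists B => _ [F _ <-]; exact: wB.
have [_ [F _ <-] supF] := sup_adherent e0 Ssup.
exists (partial_sum w F), F => // G /= FG; rewrite !partial_sumE rdistrC.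
rewrite (big_fsetID _ (mem F) G)/=.
have -> : [fset x in G | x \in F]%fset = F.
  apply/fsetP => x; rewrite !inE /=; apply/andP/idP => [[]//|xF].
  by split=> //; exact: (fsubsetP FG).
rewrite addrAC subrr add0r (le_lt_trans (ler_rnorm_sum _ _ _))//.
have : \sum_(j <- G) rnorm (w j) <= sup S by apply: ub_le_sup => //; [exact: Ssup.2|exists G].
rewrite (big_fsetID _ (mem F) G)/=.
have -> : [fset x in G | x \in F]%fset = F.
  apply/fsetP => x; rewrite !inE /=; apply/andP/idP => [[]//|xF].
  by split=> //; exact: (fsubsetP FG).
by move: supF; lra.
Qed.

Lemma l2_cvg a : l2 A a ->
  partial_sum (fun j => cmul (adj (a j)) (a j)) @ totally -->
    summability.sum (fun j => cmul (adj (a j)) (a j)).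
Proof. by []. Qed.

Lemma l2norm_sqr a : l2norm A a ^+ 2 = rnorm (summability.sum (fun j => cmul (adj (a j)) (a j))).
Proof. by rewrite sqr_sqrtr// rnorm_ge0. Qed.

Lemma l2norm_ge0 a : 0 <= l2norm A a.
Proof. exact: sqrtr_ge0. Qed.

(** On a partial sum over a set containing [j], [h] gives a sum of squares including [|h (a j)|^2];
    characters are contractive, and the partial sums converge. *)
Lemma char_le_l2norm (h : A -> R[i]) a j : spectrum A h -> l2 A a ->
  rnorm (h (a j)) <= l2norm A a.
Proof.
move=> hP /l2_cvg/cvg_rnormP al.
rewrite -(@ler_pXn2r _ 2) ?nnegrE ?rnorm_ge0 ?l2norm_ge0// l2norm_sqr.
apply/ler_addgt0Pr => d d0; have [F _ aF] := al d d0.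
have /ltW := aF (j |` F)%fset (fsubsetU1 _ _); set s := summability.sum _.
set t := partial_sum _ _ => std.
have : rnorm (h (a j)) ^+ 2 <= rnorm t.
  rewrite (le_trans _ (rnorm_char hP t))// /t partial_sumE (char_sum hP).
  under eq_bigr do rewrite (char_cstar hP).
  rewrite -rmorph_sum/= ger0_rnorm; last by apply: sumr_ge0 => z _; exact: sqr_ge0.
  rewrite (big_fsetD1 j)/= ?fset1U1// lerDl.
  by apply: sumr_ge0 => z _; exact: sqr_ge0.
by have := ler_rnormD (t - s) s; rewrite subrK rdistrC; lra.
Qed.

(** By the Cauchy property, joining [j] to a large [F] changes the partial sum by at most 2, so
    [|a j|^2 <= 2 <= 2^2] off [F]. No order on [A] is involved. *)
Lemma l2_bounded a : l2 A a -> exists2 C : R, 0 <= C & forall j, rnorm (a j) <= C.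
Proof.
move=> /l2_cvg/cvg_rnormP al; have [F _ aF] := al 1 ltr01.
exists (2 + \sum_(j <- F) rnorm (a j)) => [|j].
  by rewrite addr_ge0// sumr_ge0// => i _; exact: rnorm_ge0.
have [jF|jF] := boolP (j \in F).
  rewrite (big_fsetD1 j)//= addrCA lerDl addr_ge0// sumr_ge0// => i _.
  exact: rnorm_ge0.
rewrite (@le_trans _ _ 2)//; last by rewrite lerDl sumr_ge0// => i _; exact: rnorm_ge0.
rewrite -(@ler_pXn2r _ 2) ?nnegrE ?rnorm_ge0// -rnorm_cstar.
have /ltW := aF F (fsubset_refl _).
have /ltW := aF (j |` F)%fset (fsubsetU1 _ _); set s := summability.sum _.
rewrite !partial_sumE big_fsetU1//=; set t := \sum_(i <- _) _ => h1 h2.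
have := ler_rnormD (cmul (adj (a j)) (a j) + t - s) (s - t).
rewrite addrA subrK addrK rdistrC; lra.
Qed.

(* Expanding [(a + v)^* (a + v)], the cross terms are absolutely summable because [a]
   is bounded and [v] is absolutely summable. *)
Lemma l2_perturb a v (C B : R) : l2 A a -> (forall j, rnorm (a j) <= C) ->
  l1_bound v B -> l2 A (fun j => a j + v j) /\
  l2norm A (fun j => a j + v j) ^+ 2 <= l2norm A a ^+ 2 + (2 * C + B) * B.
Proof.
move=> al aC vB.
pose w j := cmul (adj (a j)) (v j) + cmul (adj (v j)) (a j) + cmul (adj (v j)) (v j).
have wB : l1_bound w ((2 * C + B) * B).
  move=> F; have K0 : 0 <= 2 * C + B.
    by have := le_trans (rnorm_ge0 _) (aC 0); have := l1_bound_ge0 vB; lra.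
  apply: le_trans (ler_wpM2l K0 (vB F)).
  rewrite mulr_sumr; apply: ler_sum => j _.
  have vj := rnorm_ge0 (v j).
  have h1 := rnorm_cmul (adj (a j)) (v j); have h2 := rnorm_cmul (adj (v j)) (a j).
  have h3 := rnorm_cmul (adj (v j)) (v j); rewrite !rnorm_adj in h1 h2 h3.
  have k1 := ler_wpM2r vj (aC j); have k2 := ler_wpM2l vj (aC j).
  have k3 := ler_wpM2r vj (l1_bound_coord j vB).
  have := ler_rnormD (cmul (adj (a j)) (v j) + cmul (adj (v j)) (a j)) (cmul (adj (v j)) (v j)).
  have := ler_rnormD (cmul (adj (a j)) (v j)) (cmul (adj (v j)) (a j)).
  rewrite /w; lra.
have [s ws sB] := l1_bound_cvg wB.
have E : partial_sum (fun j => cmul (adj (a j + v j)) (a j + v j)) =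
    (fun F => partial_sum (fun j => cmul (adj (a j)) (a j)) F + partial_sum w F).
  apply/funext => F; rewrite !partial_sumE -big_split/=; apply: eq_bigr => j _.
  by rewrite adjD cmulDl !cmulDr !addrA.
have avl : partial_sum (fun j => cmul (adj (a j + v j)) (a j + v j)) @ totally -->
    summability.sum (fun j => cmul (adj (a j)) (a j)) + s.
  by rewrite E; apply: cvgD => //; exact: l2_cvg.
split; first by apply/cvg_ex; eexists; exact: avl.
rewrite !l2norm_sqr {1}/summability.sum (cvg_lim _ avl)//.
by rewrite (le_trans (ler_rnormD _ _))// lerD2l.
Qed.

Lemma l2_0 : l2 A (fun=> 0) /\ l2norm A (fun=> 0) = 0.
Proof.
have E : partial_sum (fun j : int => cmul (adj (0 : A)) 0) = (fun=> 0).
  by apply/funext => F; rewrite partial_sumE big1// => j _; rewrite cmul0.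
split; first by rewrite /l2/= E; exact: is_cvg_cst.
by rewrite /l2norm /summability.sum E lim_cst// rnorm0 sqrtr0.
Qed.

Lemma l1_bound_l2 v B : l1_bound v B -> l2 A v.
Proof.
move=> vB; have [l20 _] := l2_0.
have [|+ _] := l2_perturb (C := 0) l20 _ vB; first by move=> j; rewrite rnorm0.
by under eq_fun do rewrite add0r.
Qed.

End SummableSequences.

(** * Weighted shifts *)

Section BilateralShift.
Variables (R : realType) (A : cstarAlgType R).
Hypothesis cmulC : commutative (@cmul R A).
Variables (Phi PhiV : A -> A).
Hypothesis Phi_iso : isometric_star_iso Phi PhiV.
Variable b : int -> A.
Implicit Types (a v w : int -> A) (h : A -> R[i]).

Let PhiK := isoK Phi_iso.
Let PhiVK := isoVK Phi_iso.

Lemma isoZD (c : R[i]) x y : Phi (c *: x + y) = c *: Phi x + Phi y.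
Proof. exact: iso_linear Phi_iso c x y. Qed.

Lemma isoD x y : Phi (x + y) = Phi x + Phi y.
Proof. by have := isoZD 1 x y; rewrite !scale1r. Qed.

Lemma isoB x y : Phi (x - y) = Phi x - Phi y.
Proof. by have := isoZD (-1) y x; rewrite !scaleN1r addrC [RHS]addrC. Qed.

Lemma iso0 : Phi 0 = 0.
Proof. by have := isoB 0 0; rewrite !subrr. Qed.

Lemma rnorm_iso x : rnorm (Phi x) = rnorm x.
Proof. by rewrite /rnorm (iso_isometry Phi_iso). Qed.

Lemma rnorm_isoV x : rnorm (PhiV x) = rnorm x.
Proof. by rewrite -rnorm_iso PhiVK. Qed.

Lemma rnorm_iter_iso n x : rnorm (iter n Phi x) = rnorm x.
Proof. by elim: n => [//|n IH]; rewrite iterS rnorm_iso. Qed.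

Lemma isoVM x y : PhiV (cmul x y) = cmul (PhiV x) (PhiV y).
Proof. by apply: (can_inj PhiK); rewrite (isoM Phi_iso) !PhiVK. Qed.

Lemma isoVZD (c : R[i]) x y : PhiV (c *: x + y) = c *: PhiV x + PhiV y.
Proof. by apply: (can_inj PhiK); rewrite isoZD !PhiVK. Qed.

Lemma iter_isoVM n x y :
  iter n PhiV (cmul x y) = cmul (iter n PhiV x) (iter n PhiV y).
Proof. by elim: n => [//|n IH]; rewrite !iterS IH isoVM. Qed.

Lemma spectrum_iso h : spectrum A h -> spectrum A (h \o Phi).
Proof.
move=> hP; split => [c x y|x y|] /=.
- by rewrite isoZD (charZD hP).
- by rewrite (isoM Phi_iso) (charM hP).
- by have [_ _ [x hx]] := hP; exists (PhiV x); rewrite /= PhiVK.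
Qed.

Lemma spectrum_isoV h : spectrum A h -> spectrum A (h \o PhiV).
Proof.
move=> hP; split => [c x y|x y|] /=.
- by rewrite isoVZD (charZD hP).
- by rewrite isoVM (charM hP).
- by have [_ _ [x hx]] := hP; exists (Phi x); rewrite /= PhiK.
Qed.

Lemma spectrum_iter_iso n h : spectrum A h -> spectrum A (h \o iter n Phi).
Proof.
elim: n h => [//|n IH] h hP; apply: IH (h \o Phi) _.
exact: spectrum_iso.
Qed.

Lemma spectrum_iter_isoV n h : spectrum A h -> spectrum A (h \o iter n PhiV).
Proof.
elim: n h => [//|n IH] h hP; apply: IH (h \o PhiV) _.
exact: spectrum_isoV.
Qed.

Definition wshift a : int -> A := fun j => cmul (b j) (Phi (a (j - 1))).

Let cmul_big x0 x (I : Type) (s : seq I) (F : I -> A) :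
  cmul x (\big[@cmul R A/x0]_(i <- s) F i) = \big[@cmul R A/cmul x x0]_(i <- s) F i.
Proof.
elim: s => [|i s IH]; first by rewrite !big_nil.
by rewrite !big_cons cmulA (cmulC x) -cmulA IH.
Qed.

(** One more step raises every exponent of [Phi] by one and multiplies by [b j], which commutativity
    moves to the last place of the product, [k = n + 1]. *)
Lemma bilateral_shiftE n : bilateral_shift Phi b n = iter n wshift.
Proof.
apply/funext => a; elim: n => [|n IH]; apply/funext => j.
  by rewrite /bilateral_shift big_geq// subr0.
rewrite iterS /wshift -IH /bilateral_shift.
have morph x0 (s : seq nat) (F : nat -> A) :
    Phi (\big[@cmul R A/x0]_(i <- s) F i) = \big[@cmul R A/Phi x0]_(i <- s) Phi (F i).
  elim: s => [|i s IHs]; first by rewrite !big_nil.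
  by rewrite !big_cons (isoM Phi_iso) IHs.
have jn : j - 1 - n%:Z = j - n.+1%:Z by rewrite -addrA -opprD -intS.
rewrite morph cmul_big -iterS jn.
have -> : index_iota 1 n.+2 = rcons (index_iota 1 n.+1) n.+1.
  rewrite /index_iota !subSS !subn0; have := iotaD 1 n 1.
  by rewrite addn1 => ->; rewrite /= cats1 add1n.
rewrite big_rcons_op/= subnn subrK.
apply: eq_big_nat => k /andP[_ kn].
by rewrite -iterS -subSn// jn.
Qed.

(** The induction runs over all characters: splitting off the outer weight leaves the character
    [h o Phi] at the coordinate [j - 1]. *)
Lemma char_wshift h n a j : spectrum A h ->
  h (iter n wshift a j) =
  (\prod_(1 <= i < n.+1) h (iter i.-1 Phi (b (j - i%:Z + 1)))) * h (iter n Phi (a (j - n%:Z))).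
Proof.
elim: n h j => [|n IH] h j hP; first by rewrite big_geq// mul1r subr0.
have jE (m : nat) : j - 1 - m%:Z = j - m.+1%:Z by rewrite -addrA -opprD -intS.
rewrite iterS {1}/wshift (charM hP); have /= -> := IH (h \o Phi) (j - 1) (spectrum_iso hP).
rewrite [in RHS]big_nat_recl// mulrA subrK; congr (_ * _ * _).
  apply: eq_big_nat => i /andP[i0 _].
  by rewrite -iterS prednK// jE.
by rewrite jE.
Qed.

(** Here the new weight is the last factor: [Phi^-(n+1)] undoes the outer [Phi] and reduces to the
    coordinate [j + n] after [n] steps. *)
Lemma char_wshift_isoV h n a j : spectrum A h ->
  h (iter n PhiV (iter n wshift a (j + n%:Z))) =
  (\prod_(1 <= i < n.+1) h (iter i PhiV (b (i%:Z + j)))) * h (a j).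
Proof.
move=> hP; elim: n => [|n IH]; first by rewrite big_geq// mul1r addr0.
rewrite [iter n.+1 wshift a]iterS /wshift iter_isoVM (charM hP).
rewrite [iter n.+1 PhiV (Phi _)]iterSr PhiK.
have -> : j + n.+1%:Z - 1 = j + n%:Z by rewrite intS addrCA addrAC subrr add0r.
by rewrite IH [in RHS]big_nat_recr// (addrC j) mulrA (mulrC (h _)).
Qed.

End BilateralShift.

(** * Hypercyclicity implies the weight condition *)

(** Points are avoided one at a time. If [u N] is hit, [t] moves by some [s <= d / 2]: the earlier
    points stay at distance at least [s], and [u N] is at distance exactly [s]. *)
Lemma avoid_near (R : realType) (u : nat -> R[i]) (c : R[i]) (eps : R) N : 0 < eps ->
  exists t d : R, [/\ 0 < t, t < eps, 0 < d
    & forall m, (m < N)%N -> d <= rnorm (u m - (c + t%:C))].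
Proof.
move=> eps0; elim: N => [|N [t [d [t0 te d0 td]]]].
  by exists (eps / 2), 1; split; rewrite ?ltr01//; lra.
have [uN|uN] := eqVneq (u N) (c + t%:C); last first.
  exists t, (Num.min d (rnorm (u N - (c + t%:C)))); split => //.
    by rewrite lt_min d0 rnorm_gt0// subr_eq0.
  move=> m; rewrite ltnS leq_eqVlt ge_min => /orP[/eqP ->|/td ->//].
  by rewrite lexx orbT.
pose s := Num.min (d / 2) ((eps - t) / 2).
have s0 : 0 < s by rewrite lt_min; apply/andP; split; lra.
have sd : s <= d / 2 by rewrite ge_min lexx.
have se : s <= (eps - t) / 2 by rewrite ge_min lexx orbT.
exists (t + s), s; split => //; [lra|lra|].
have us m : u m - (c + (t + s)%:C) = (u m - (c + t%:C)) - s%:C.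
  by rewrite rmorphD/= addrA opprD addrA.
move=> m; rewrite ltnS us leq_eqVlt => /orP[/eqP ->|/td tm].
  by rewrite uN subrr sub0r rnormN ger0_rnorm// ltW.
have := ler_rnormD (u m - (c + t%:C) - s%:C) (s%:C).
by rewrite subrK ger0_rnorm ?(ltW s0)//; lra.
Qed.

Section HypercyclicImpliesWeights.
Variables (R : realType) (A : cstarAlgType R).
Hypothesis cmulC : commutative (@cmul R A).
Variables (Phi PhiV : A -> A).
Hypothesis Phi_iso : isometric_star_iso Phi PhiV.
Variable b : int -> A.
Implicit Types (a v w : int -> A) (h : A -> R[i]).

Local Notation T := (wshift Phi b).

Variable x0 : int -> A.
Hypothesis x0_dense : dense_in (l2 A) (l2norm A) (range (fun n => bilateral_shift Phi b n x0)).

(* The orbit keeps its density when finitely many of its points are removed: move the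
   target a little in the coordinate 0, so that one character separates it from them. *)
Lemma orbit_tail_dense (h0 : A -> R[i]) y (B eps : R) N :
  spectrum A h0 -> l1_bound y B -> 0 < eps -> exists2 n, (N <= n)%N &
    forall h j, spectrum A h -> rnorm (h (iter n T x0 j) - h (y j)) < eps.
Proof.
move=> h0P yB eps0; have [orb_l2 orb_dense] := x0_dense.
(* Adding [t g] to the coordinate 0 then shifts the value of [h0] there by exactly [t]. *)
have [g g1] : exists g, h0 g = 1.
  have [_ _ [x /eqP hx]] := h0P; exists ((h0 x)^-1 *: x).
  by rewrite (charZ h0P) mulVf.
have g0 := rnorm_ge0 g.
pose e' := eps / 2 / (rnorm g + 1).
have e'0 : 0 < e' by rewrite divr_gt0//; lra.
have [t [d [t0 te d0 td]]] := avoid_near (fun m => h0 (iter m T x0 0)) (h0 (y 0)) N e'0.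
pose v (j : int) := if j == 0 then t%:C *: g else 0.
pose z (j : int) := y j + v j.
have vB : l1_bound v (t * rnorm g).
  have -> : t * rnorm g = \sum_(j <- [fset 0]%fset) rnorm (v j).
    by rewrite big_seq_fset1 /v eqxx rnormZ ger0_rnorm// ltW.
  by apply: l1_bound_fsupp => j; rewrite inE /v => /negPf ->.
have zB : l1_bound z (B + t * rnorm g) by exact: l1_boundD.
(* Accuracy [d] excludes the first [N] orbit points; accuracy [eps / 2] leaves room for the
   displacement [t g]. *)
have [_ [n _ <-]] := orb_dense z (l1_bound_l2 zB) (Num.min (eps / 2) d)
  ltac:(by rewrite lt_min d0 andbT divr_gt0).
have nl2 : l2 A (iter n T x0).
  by rewrite -(bilateral_shiftE cmulC Phi_iso); apply: orb_l2; exists n.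
rewrite (bilateral_shiftE cmulC Phi_iso) lt_min => /andP[ne nd].
have dl2 : l2 A (iter n T x0 - z).
  have [C C0 nC] := l2_bounded nl2.
  have zNB : l1_bound (fun j => - z j) (B + t * rnorm g).
    by apply: l1_bound_le zB _ => j; rewrite rnormN.
  by have [] := l2_perturb nl2 nC zNB.
exists n => [|h j hP].
  rewrite leqNgt; apply/negP => /td; rewrite leNgt => /negP; apply.
  apply: le_lt_trans nd; have := char_le_l2norm 0 h0P dl2.
  rewrite (_ : (iter n T x0 - z) 0 = iter n T x0 0 - z 0)//.
  by rewrite (charB h0P) /z /v eqxx (charD h0P) (charZ h0P) g1 mulr1.
have hz : rnorm (h (v j)) <= t * rnorm g.
  exact: le_trans (rnorm_char hP _) (l1_bound_coord _ vB).
have tg : t * rnorm g <= eps / 2.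
  have : t * (rnorm g + 1) <= eps / 2 by rewrite -ler_pdivlMr ?ltW//; lra.
  have := ltW t0; lra.
have := char_le_l2norm j hP dl2.
rewrite (_ : (iter n T x0 - z) j = iter n T x0 j - z j)// (charB hP) /z (charD hP).
have := ler_rnormD (h (iter n T x0 j) - (h (y j) + h (v j))) (h (v j)).
rewrite opprD addrA subrK; lra.
Qed.

(** Let [x] and [T^n x] both be near [y]. As [N] exceeds every index in [I], [y] vanishes at [j + n]
    and at [j - n]: so the product times [|h (x j)| >= 1 - eps] is below [eps], while the other
    product times a number below [eps] is at least [1 - eps]. The characters [h o Phi^-n] and
    [h o Phi^n] occur, hence the uniformity in [orbit_tail_dense]. *)
Lemma orbit_weights (K : set {ptws A -> R[i]^o}) (I : set nat) (eps : R) N :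
  K !=set0 -> compact K -> K `<=` spectrum A ->
  finite_set I -> (forall j, I j -> (0 < j < N)%N) -> 0 < eps < 1 ->
  exists2 n, (N <= n)%N & forall j h, I j -> K h ->
    \prod_(1 <= i < n.+1) rnorm (h (iter i PhiV (b (i%:Z + j%:Z))) : R[i])
      <= eps / (1 - eps) /\
    (1 - eps) / eps <= \prod_(1 <= i < n.+1)
      rnorm (h (iter i.-1 Phi (b (j%:Z - i%:Z + 1))) : R[i]).
Proof.
move=> [h0 Kh0] Kc KA Ifin IN /andP[eps0 eps1].
have [f Kf] := compact_spectrum_separated Kc KA.
pose y (j : int) := if `[< exists2 i, I i & j = i%:Z >] then f else 0.
have yI i : I i -> y i%:Z = f.
  by move=> Ii; rewrite /y; case: asboolP => // -[]; exists i.
have yN j : (forall i, (0 < i < N)%N -> j <> i%:Z) -> y j = 0.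
  by move=> jN; rewrite /y; case: asboolP => // -[i /IN iN ji]; case: (jN i).
pose J : {fset int} := [fset Posz i | i in fset_set I]%fset.
have yB : l1_bound y (\sum_(j <- J) rnorm (y j)).
  apply: l1_bound_fsupp => j jJ; rewrite /y; case: asboolP => // -[i Ii ji].
  by case/negP: jJ; apply/imfsetP; exists i => //=; rewrite in_fset_set// inE.
have [m _ Tm] := orbit_tail_dense 0 (KA _ Kh0) yB eps0.
have [k mk Tk] := orbit_tail_dense (m + N) (KA _ Kh0) yB eps0.
exists (k - m)%N; first by rewrite leq_subRL ?(leq_trans _ mk)// leq_addr.
set n := (k - m)%N; set x := iter m T x0 in Tm.
have xk : iter k T x0 = iter n T x by rewrite -iterD subnK// (leq_trans _ mk)// leq_addr.
rewrite {}xk in Tk.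
have Nn : (N <= n)%N by rewrite leq_subRL ?(leq_trans _ mk)// leq_addr.
move=> j h Ij Kh; have hP := KA _ Kh; have /andP[j0 jN] := IN _ Ij.
have hf : 1 <= rnorm (h f : R[i]) by exact: Kf.
have small (u v : R[i]) : rnorm (u - v) < eps -> 1 <= rnorm v -> 1 - eps <= rnorm u.
  by move=> uv v1; have := ler_rnormB u (u - v); rewrite opprB addrC subrK; lra.
split.
- have := Tk _ (j%:Z + n%:Z) (spectrum_iter_isoV Phi_iso n hP).
  rewrite (yN (j%:Z + n%:Z)); last by move=> i /andP[_ iN] [] ji; move: iN; rewrite -ji; lia.
  rewrite (char0 (spectrum_iter_isoV Phi_iso n hP)) subr0/=.
  rewrite (char_wshift_isoV Phi_iso b n x j%:Z hP) rnormM rnorm_prod => /ltW le_eps.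
  have := Tm _ j%:Z hP; rewrite yI// => /small/(_ hf) hx.
  rewrite ler_pdivlMr ?subr_gt0//; apply: le_trans le_eps.
  by rewrite ler_wpM2l// prodr_ge0// => i _; exact: rnorm_ge0.
- have := Tk _ j%:Z hP; rewrite yI// => /small/(_ hf).
  rewrite (char_wshift Phi_iso b n x j%:Z hP) rnormM rnorm_prod => le_eps.
  have := Tm _ (j%:Z - n%:Z) (spectrum_iter_iso Phi_iso n hP).
  rewrite (yN (j%:Z - n%:Z)); last by move=> i /andP[i0 iN] ji; lia.
  rewrite (char0 (spectrum_iter_iso Phi_iso n hP)) subr0/= => /ltW hx.
  rewrite ler_pdivrMr//; apply: le_trans le_eps _.
  by rewrite ler_wpM2l// prodr_ge0// => i _; exact: rnorm_ge0.
Qed.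

End HypercyclicImpliesWeights.

(** * Suprema and products in the extended reals *)

Section ErealWeights.
Variable R : realType.
Implicit Types (T : Type).

(** [K] is non-empty because the supremum of the empty set is [-oo]. *)
Lemma ereal_sup_image_cvg0 T (K : set T) (f : nat -> T -> \bar R) :
  K !=set0 -> (forall k h, K h -> (0 <= f k h <= (k.+1%:R^-1)%:E)%E) ->
  (fun k => ereal_sup [set f k h | h in K]) @ \oo --> 0%E.
Proof.
move=> [h0 Kh0] fK.
apply: (@squeeze_cvge _ _ _ _ (fun=> 0%E) _ (fun k => (k.+1%:R^-1)%:E)).
- apply: nearW => k; apply/andP; split.
    apply: (@le_trans _ _ (f k h0)); first by have /andP[] := fK k h0 Kh0.
    by apply: ereal_sup_ubound; exists h0.
  by apply: ge_ereal_sup => _ [h Kh <-]; have /andP[] := fK k h Kh.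
- exact: cvg_cst.
- by apply: cvg_EFin; [exact: nearW|exact: cvg_harmonic].
Qed.

Lemma ereal_sup_image_cvg0_lt T (K : set T) (f : nat -> T -> \bar R) (eps : R) :
  (fun k => ereal_sup [set f k h | h in K]) @ \oo --> 0%E -> 0 < eps ->
  exists k0, forall k h, (k0 <= k)%N -> K h -> (f k h < eps%:E)%E.
Proof.
move=> f0 eps0.
have /f0[k0 _ Hk0] : nbhs (0%E : \bar R) [set y | (y < eps%:E)%E].
  apply: (@open_nbhs_nbhs _ (0%E : \bar R)); split; first exact: open_ereal_lt_ereal.
  by rewrite /= lte_fin.
exists k0 => k h k0k Kh; apply: le_lt_trans (Hk0 k k0k).
by apply: ereal_sup_ubound; exists h.
Qed.

Lemma prode_inv (I : Type) (s : seq I) (f : I -> R) : \prod_(i <- s) f i != 0 ->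
  (\prod_(i <- s) ((f i)%:E)^-1 = ((\prod_(i <- s) f i)^-1)%:E)%E.
Proof.
elim: s => [|i s IH]; first by rewrite !big_nil invr1.
rewrite !big_cons mulf_eq0 negb_or => /andP[fi /IH ->].
by rewrite inver (negPf fi) -EFinM invfM.
Qed.

End ErealWeights.

Section HypercyclicImpliesWeightCondition.
Variables (R : realType) (A : cstarAlgType R).
Hypothesis cmulC : commutative (@cmul R A).
Variables (Phi PhiV : A -> A).
Hypothesis Phi_iso : isometric_star_iso Phi PhiV.
Variable b : int -> A.

Lemma hypercyclic_weight_condition :
  hypercyclic (l2 A) (l2norm A) (bilateral_shift Phi b) -> weight_condition Phi PhiV b.
Proof.
move=> [x0 _ x0_dense] K K0 Kc KA I I0 Ifin Ipos.
have [N IN] : exists N, forall j, I j -> (0 < j < N)%N.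
  exists (\max_(i <- fset_set I) i).+1 => j Ij; rewrite Ipos// ltnS.
  by apply: leq_bigmax_seq => //; rewrite in_fset_set// inE.
(* Chosen so that [eps / (1 - eps)] is [1 / (k + 1)]. *)
pose eps k : R := k.+2%:R^-1.
have eps01 k : 0 < eps k < 1 by rewrite invr_gt0 ltr0n invf_lt1 ?ltr0n// ltr1n.
have epsE k : eps k / (1 - eps k) = k.+1%:R^-1.
  have t0 : 0 < k.+1%:R :> R by rewrite ltr0n.
  rewrite /eps -[k.+2%:R]natr1; move: k.+1%:R t0 => t t0.
  by field; rewrite !gt_eqF// ltr_wpDr.
have /choice[n nP] (u : nat * nat) : exists n, (N + u.2 <= n)%N /\
    forall j h, I j -> K h ->
    \prod_(1 <= i < n.+1) rnorm (h (iter i PhiV (b (i%:Z + j%:Z))) : R[i])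
      <= eps u.1 / (1 - eps u.1) /\
    (1 - eps u.1) / eps u.1 <= \prod_(1 <= i < n.+1)
      rnorm (h (iter i.-1 Phi (b (j%:Z - i%:Z + 1))) : R[i]).
  have IN' j : I j -> (0 < j < N + u.2)%N.
    by move=> /IN/andP[-> jN]; rewrite (leq_trans jN)// leq_addr.
  have [n] := orbit_weights cmulC Phi_iso x0_dense K0 Kc KA Ifin IN' (eps01 u.1).
  by exists n.
(* The second argument of [n] is a lower bound on its value; passing [r k' + 1] makes [r] strictly
   increasing. *)
pose r := fix r k := if k is k'.+1 then n (k, (r k').+1) else n (0, 1)%N.
have rE k : exists m, r k = n (k, m.+1) by case: k => [|k]; [exists 0%N|exists (r k)].
exists r; split=> [k||j Ij].
- have [m ->] := rE k; have [+ _] := nP (k, m.+1); by rewrite addnS; apply: leq_trans.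
- apply: (homo_ltn ltn_trans) => k; have [+ _] := nP (k.+1, (r k).+1).
  by rewrite addnS; apply: leq_trans; rewrite ltnS leq_addl.
- split; apply: ereal_sup_image_cvg0 => // k h Kh; have [m ->] := rE k;
    have [_ /(_ j h Ij Kh)[le1 le2]] := nP (k, m.+1); rewrite /= epsE in le1 le2.
  + rewrite prodEFin !lee_fin le1 andbT; apply: prodr_ge0 => i _; exact: rnorm_ge0.
  + have e0 : 0 < (1 - eps k) / eps k.
      by have /andP[? ?] := eps01 k; rewrite divr_gt0// subr_gt0.
    have P0 := lt_le_trans e0 le2.
    rewrite prode_inv ?gt_eqF// !lee_fin invr_ge0 (ltW P0)/= -epsE.
    by rewrite -[eps k / _]invf_div lef_pV2 ?posrE.
Qed.

End HypercyclicImpliesWeightCondition.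

(** * The weight condition implies hypercyclicity *)

Section InvertibleShift.
Variables (R : realType) (A : cstarAlgType R).
Hypothesis cmulC : commutative (@cmul R A).
Variables (Phi PhiV : A -> A).
Hypothesis Phi_iso : isometric_star_iso Phi PhiV.
Variable e : A.
Hypothesis eP : is_unit_of e.
Variables b binv : int -> A.
Hypothesis bK : forall j, cmul (b j) (binv j) = e /\ cmul (binv j) (b j) = e.
Implicit Types (a v w : int -> A) (h : A -> R[i]).

Local Notation T := (wshift Phi b).

Definition wshiftV a : int -> A := fun j => PhiV (cmul (binv (j + 1)) (a (j + 1))).

Local Notation S := wshiftV.

Lemma wshiftK : cancel T S.
Proof.
move=> a; apply/funext => j; rewrite /wshiftV /wshift addrK cmulA (bK _).2 (eP _).1.
exact: isoK Phi_iso _.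
Qed.

Lemma wshiftVK : cancel S T.
Proof.
move=> a; apply/funext => j.
by rewrite /wshiftV /wshift (isoVK Phi_iso) subrK cmulA (bK _).1 (eP _).1.
Qed.

Lemma iter_wshiftVK n : cancel (iter n S) (iter n T).
Proof. by elim: n => [//|n IH] a; rewrite iterSr iterS wshiftVK IH. Qed.

Lemma iter_wshiftK n : cancel (iter n T) (iter n S).
Proof. by elim: n => [//|n IH] a; rewrite iterSr iterS wshiftK IH. Qed.

Lemma wshiftD a v : T (fun j => a j + v j) = (fun j => T a j + T v j).
Proof. by apply/funext => j; rewrite /wshift (isoD Phi_iso) cmulDr. Qed.

Lemma wshiftVD a v : S (fun j => a j + v j) = (fun j => S a j + S v j).
Proof.
apply/funext => j; rewrite /wshiftV cmulDr.
by have := isoVZD Phi_iso 1; rewrite /= => H; rewrite -[cmul _ (a _)]scale1r H !scale1r.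
Qed.

Lemma iter_wshiftD n a v :
  iter n T (fun j => a j + v j) = (fun j => iter n T a j + iter n T v j).
Proof. by elim: n => [//|n IH]; rewrite !iterS IH wshiftD. Qed.

Lemma iter_wshiftVD n a v :
  iter n S (fun j => a j + v j) = (fun j => iter n S a j + iter n S v j).
Proof. by elim: n => [//|n IH]; rewrite !iterS IH wshiftVD. Qed.

Lemma iter_wshift_local n a v j : a (j - n%:Z) = v (j - n%:Z) ->
  iter n T a j = iter n T v j.
Proof.
elim: n j => [j|n IH j av]; first by rewrite subr0.
rewrite !iterS /wshift (IH (j - 1))//.
by rewrite (_ : j - 1 - n%:Z = j - n.+1%:Z)//; lia.
Qed.

Lemma iter_wshiftV_eq0 n a j : a (j + n%:Z) = 0 -> iter n S a j = 0.
Proof.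
elim: n j => [j|n IH j av]; first by rewrite addr0.
rewrite iterS /wshiftV (IH (j + 1)) ?cmul0.
  by apply: rnorm0_eq0; rewrite (rnorm_isoV Phi_iso) rnorm0.
by rewrite (_ : j + 1 + n%:Z = j + n.+1%:Z)//; lia.
Qed.

Lemma l1_bound_shift a B (k : int) : l1_bound a B -> l1_bound (fun j => a (j + k)) B.
Proof.
move=> aB F; have := aB [fset (j + k : int) | j in F]%fset.
by rewrite big_imfset//= => i j _ _; exact: addIr.
Qed.

Lemma l1_boundZ a v (k B : R) : 0 <= k -> l1_bound a B ->
  (forall j, rnorm (v j) <= k * rnorm (a j)) -> l1_bound v (k * B).
Proof.
move=> k0 aB va F; apply: le_trans (ler_wpM2l k0 (aB F)).
by rewrite mulr_sumr; apply: ler_sum => j _.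
Qed.

Lemma l1_bound_trans a (B D : R) : B <= D -> l1_bound a B -> l1_bound a D.
Proof. by move=> BD aB F; exact: le_trans (aB F) BD. Qed.

Definition delta (j : int) (x : A) : int -> A := fun i => if i == j then x else 0.

Lemma l1_bound_delta j x : l1_bound (delta j x) (rnorm x).
Proof.
have -> : rnorm x = \sum_(i <- [fset j]%fset) rnorm (delta j x i).
  by rewrite big_seq_fset1 /delta eqxx.
by apply: l1_bound_fsupp => i; rewrite inE /delta => /negPf ->.
Qed.

Lemma wshift_delta j x : T (delta j x) = delta (j + 1) (cmul (b (j + 1)) (Phi x)).
Proof.
apply/funext => i; rewrite /wshift /delta subr_eq.
by case: eqVneq => [->//|_]; rewrite (iso0 Phi_iso) cmul0.
Qed.

Lemma wshiftV_delta j x : exists x', S (delta j x) = delta (j - 1) x'.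
Proof.
exists (PhiV (cmul (binv j) x)); apply/funext => i; rewrite /wshiftV /delta.
rewrite -[i == j - 1]subr_eq opprK.
case: eqVneq => [->//|_]; rewrite cmul0.
by apply: rnorm0_eq0; rewrite (rnorm_isoV Phi_iso) rnorm0.
Qed.

Lemma iter_wshift_delta n j x : exists x', iter n T (delta j x) = delta (j + n%:Z) x'.
Proof.
elim: n => [|n [x' IH]]; first by exists x; rewrite addr0.
exists (cmul (b (j + n%:Z + 1)) (Phi x')); rewrite iterS IH wshift_delta.
by congr delta; lia.
Qed.

Lemma iter_wshiftV_delta n j x : exists x', iter n S (delta j x) = delta (j - n%:Z) x'.
Proof.
elim: n => [|n [x' IH]]; first by exists x; rewrite subr0.
have [x'' E] := wshiftV_delta (j - n%:Z) x'; exists x''; rewrite iterS IH E.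
by congr delta; lia.
Qed.

Variable C : R.
Hypothesis C1 : 1 <= C.
Hypothesis bC : forall j, rnorm (b j) <= C.
Hypothesis binvC : forall j, rnorm (binv j) <= C.

Let C0 : 0 < C. Proof. exact: lt_le_trans ltr01 C1. Qed.

Lemma l1_bound_wshift a B : l1_bound a B -> l1_bound (T a) (C * B).
Proof.
move=> /(@l1_bound_shift _ _ (-1))/l1_boundZ; apply; first exact: ltW.
move=> j; rewrite (le_trans (rnorm_cmul _ _))// (rnorm_iso Phi_iso).
by rewrite ler_wpM2r ?rnorm_ge0.
Qed.

Lemma l1_bound_wshiftV a B : l1_bound a B -> l1_bound (S a) (C * B).
Proof.
move=> /(@l1_bound_shift _ _ 1)/l1_boundZ; apply; first exact: ltW.
move=> j; rewrite /wshiftV (rnorm_isoV Phi_iso) (le_trans (rnorm_cmul _ _))//.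
by rewrite ler_wpM2r ?rnorm_ge0.
Qed.

Lemma l1_bound_iter_wshift n a B : l1_bound a B -> l1_bound (iter n T a) (C ^+ n * B).
Proof.
move=> aB; elim: n => [|n IH]; first by rewrite mul1r.
by rewrite iterS exprS -mulrA; exact: l1_bound_wshift.
Qed.

Lemma l1_bound_iter_wshiftV n a B : l1_bound a B -> l1_bound (iter n S a) (C ^+ n * B).
Proof.
move=> aB; elim: n => [|n IH]; first by rewrite mul1r.
by rewrite iterS exprS -mulrA; exact: l1_bound_wshiftV.
Qed.

Variable r : nat -> nat.

(** Finite support lets high iterates of [S] vanish near the coordinate 0, as the construction of
    the hypercyclic vector requires. *)
Definition null_vector a :=
  (exists N : nat, forall j, (N < `|j|)%N -> a j = 0) /\
  forall eta : R, 0 < eta -> exists k0, forall k, (k0 <= k)%N ->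
    l1_bound (iter (r k) T a) eta /\ l1_bound (iter (r k) S a) eta.

Lemma null_vectorD a v : null_vector a -> null_vector v ->
  null_vector (fun j => a j + v j).
Proof.
move=> [[N aN] a0] [[M vM] v0]; split.
  exists (maxn N M) => j; rewrite gtn_max => /andP[/aN -> /vM ->].
  by rewrite addr0.
move=> eta eta0; have eta2 : 0 < eta / 2 by rewrite divr_gt0.
have [k ak] := a0 _ eta2; have [l vl] := v0 _ eta2.
exists (maxn k l) => m; rewrite geq_max => /andP[/ak[a1 a2] /vl[v1 v2]].
rewrite iter_wshiftD iter_wshiftVD (splitr eta).
by split; exact: l1_boundD.
Qed.

Lemma null_vector0 : null_vector (fun=> 0).
Proof.
split; first by exists 0%N.
have S0 n : iter n S (fun=> 0) = fun=> 0.
  by apply/funext => j; exact: iter_wshiftV_eq0.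
have T0 n : iter n T (fun=> 0) = fun=> 0.
  by rewrite -[RHS](iter_wshiftVK n) S0.
move=> eta eta0; exists 0%N => k _; rewrite S0 T0.
by split => F; rewrite big1 ?ltW// => j _; rewrite rnorm0.
Qed.

(** [T] commutes with the iterates of [T] and [S] and expands l^1 bounds by at most [C], hence the
    accuracy [eta / C]. *)
Lemma null_vector_wshift a : null_vector a -> null_vector (T a).
Proof.
move=> [[N aN] a0]; split.
  exists N.+1 => j jN; rewrite /wshift aN ?(iso0 Phi_iso) ?cmul0//; lia.
have comm n : iter n S (T a) = T (iter n S a).
  by elim: n => [//|n IH]; rewrite !iterS IH wshiftK wshiftVK.
move=> eta eta0; have [k ak] := a0 _ (divr_gt0 eta0 C0).
exists k => m /ak[a1 a2]; rewrite comm -iterSr iterS.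
have -> : eta = C * (eta / C) by rewrite mulrC divfK ?gt_eqF.
by split; exact: l1_bound_wshift.
Qed.

Lemma null_vector_wshiftV a : null_vector a -> null_vector (S a).
Proof.
move=> [[N aN] a0]; split.
  exists N.+1 => j jN; rewrite -[S a]/(iter 1 S a) iter_wshiftV_eq0// aN//; lia.
have comm n : iter n T (S a) = S (iter n T a).
  by elim: n => [//|n IH]; rewrite !iterS IH wshiftK wshiftVK.
move=> eta eta0; have [k ak] := a0 _ (divr_gt0 eta0 C0).
exists k => m /ak[a1 a2]; rewrite comm -iterSr iterS.
have -> : eta = C * (eta / C) by rewrite mulrC divfK ?gt_eqF.
by split; exact: l1_bound_wshiftV.
Qed.

Hypothesis weights : forall eps : R, 0 < eps -> exists k0, forall k h,
  (k0 <= k)%N -> spectrum A h ->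
  \prod_(1 <= i < (r k).+1) rnorm (h (iter i PhiV (b (i%:Z + 1))) : R[i]) <= eps /\
  1 <= eps * \prod_(1 <= i < (r k).+1) rnorm (h (iter i.-1 Phi (b (1 - i%:Z + 1))) : R[i]).

(** Each iterate is supported at one coordinate, so a norm in [A] is to be estimated, through
    characters. For [S], the product formula is applied to [T^n (S^n (delta 1 x)) = delta 1 x]. *)
Lemma null_vector_delta1 x : null_vector (delta 1 x).
Proof.
split; first by exists 1%N => j j1; rewrite /delta; case: eqVneq => // j1'; lia.
move=> eta eta0; have x0 := rnorm_ge0 x.
have [|k0 wk] := @weights (eta / (rnorm x + 1)); first by rewrite divr_gt0// ltr_wpDl.
set eps := eta / _ in wk; have epsx : eps * rnorm x <= eta.
  by rewrite /eps mulrAC ler_pdivrMr ?ltr_wpDl// ler_wpM2l ?(ltW eta0)// lerDl.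
have eps0 : 0 <= eps by rewrite divr_ge0 ?(ltW eta0)// addr_ge0.
exists k0 => k k0k; set n := r k; split.
- have [y E] := iter_wshift_delta n 1 x; rewrite E.
  apply: l1_bound_trans (l1_bound_delta _ _); apply: le_trans epsx.
  have -> : y = iter n T (delta 1 x) (1 + n%:Z) by rewrite E /delta eqxx.
  rewrite -(_ : rnorm (iter n PhiV (iter n T (delta 1 x) (1 + n%:Z))) = rnorm _); last first.
    by elim: (n in iter n PhiV _) => [//|m IH]; rewrite iterS (rnorm_isoV Phi_iso).
  apply: (rnorm_le_char cmulC eP) => [|h hP]; first by rewrite mulr_ge0.
  rewrite (char_wshift_isoV Phi_iso _ _ _ _ hP) rnormM rnorm_prod.
  rewrite ler_pM ?rnorm_ge0//; first by apply: prodr_ge0 => i _; exact: rnorm_ge0.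
    by have [] := wk k h k0k hP.
  by rewrite /delta eqxx rnorm_char.
- have [y E] := iter_wshiftV_delta n 1 x; rewrite E.
  apply: l1_bound_trans (l1_bound_delta _ _); apply: le_trans epsx.
  rewrite -(rnorm_iter_iso Phi_iso n).
  apply: (rnorm_le_char cmulC eP) => [|h hP]; first by rewrite mulr_ge0.
  have hx := char_wshift Phi_iso b n (iter n S (delta 1 x)) 1 hP.
  have [_ w1] := wk k h k0k hP; rewrite -/n in w1.
  rewrite iter_wshiftVK E /delta !eqxx in hx.
  have := congr1 (fun z : R[i] => rnorm z) hx; rewrite rnormM rnorm_prod => {}hx.
  apply: le_trans (ler_wpM2l eps0 (rnorm_char hP x)); rewrite hx mulrA.
  by rewrite ler_peMl ?rnorm_ge0.
Qed.

(** [T] and [S] carry the property from the coordinate 1 to its neighbours; since they are mutually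
    inverse, every [delta] is reached. *)
Lemma null_vector_delta j x : null_vector (delta j x).
Proof.
have up k y : null_vector (delta (1 + k%:Z) y).
  elim: k y => [|k IH] y; first by rewrite addr0; exact: null_vector_delta1.
  rewrite -[delta _ y]wshiftVK; apply: null_vector_wshift.
  have [y' ->] := wshiftV_delta (1 + k.+1%:Z) y.
  by rewrite (_ : 1 + k.+1%:Z - 1 = 1 + k%:Z)//; lia.
have down k y : null_vector (delta (1 - k%:Z) y).
  elim: k y => [|k IH] y; first by rewrite subr0; exact: null_vector_delta1.
  rewrite -[delta _ y]wshiftK; apply: null_vector_wshiftV; rewrite wshift_delta.
  by rewrite (_ : 1 - k.+1%:Z + 1 = 1 - k%:Z)//; lia.
have [j1|j1] := leP 1 j.
  by rewrite (_ : j = 1 + `|j - 1|%N%:Z); [exact: up|lia].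
by rewrite (_ : j = 1 - `|1 - j|%N%:Z); [exact: down|lia].
Qed.

End InvertibleShift.

(** * Construction of the hypercyclic vector *)

Section Construction.
Variables (R : realType) (A : cstarAlgType R).
Variables (Phi PhiV : A -> A).
Hypothesis Phi_iso : isometric_star_iso Phi PhiV.
Variable e : A.
Hypothesis eP : is_unit_of e.
Variables b binv : int -> A.
Hypothesis bK : forall j, cmul (b j) (binv j) = e /\ cmul (binv j) (b j) = e.
Variable C : R.
Hypothesis C1 : 1 <= C.
Hypothesis bC : forall j, rnorm (b j) <= C.
Hypothesis binvC : forall j, rnorm (binv j) <= C.
Implicit Types (a v w : int -> A) (h : A -> R[i]).

Local Notation T := (wshift Phi b).
Local Notation S := (wshiftV PhiV binv).

Variable r : nat -> nat.
Hypothesis r_mono : {homo r : k l / (k < l)%N}.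
Variable Y : nat -> int -> A.
Hypothesis Y_null : forall m, null_vector Phi PhiV b binv r (Y m).

Let q (k : nat) : R := 2^-1 ^+ k.
Let q0 k : 0 < q k. Proof. by rewrite exprn_gt0// invr_gt0. Qed.

Lemma iter_wshiftV_null n a :
  null_vector Phi PhiV b binv r a -> null_vector Phi PhiV b binv r (iter n S a).
Proof.
by elim: n => [//|n IH] /IH; rewrite iterS; exact: (null_vector_wshiftV Phi_iso eP bK C1 binvC).
Qed.

(** [X] is the sum built so far and [S^n (Y k)] the next summand. The divisor [C ^ N] keeps that
    summand below [q k] under up to [N] applications of [T], that is, at all earlier times. *)
Lemma next_time (k N : nat) X : null_vector Phi PhiV b binv r X -> exists n,
  [/\ l1_bound (iter n T X) (q k), l1_bound (iter n S (Y k)) (q k / C ^+ N)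
    & forall j, (`|j| <= k)%N -> iter n S (Y k) j = 0].
Proof.
have C0 : 0 < C := lt_le_trans ltr01 C1.
move=> [_ X0]; have [[M YM] Y0] := Y_null k.
have [k1 X1] := X0 _ (q0 k).
have [k2 Y2] := Y0 (q k / C ^+ N) (divr_gt0 (q0 k) (exprn_gt0 N C0)).
have r_ge m : (m <= r m)%N.
  elim: m => [//|m IH]; apply: leq_ltn_trans IH _; exact: r_mono.
pose m := maxn (maxn k1 k2) (M + k).+1.
have /X1[X2 _] : (k1 <= m)%N by rewrite !leq_max leqnn.
have /Y2[_ Y3] : (k2 <= m)%N by rewrite !leq_max leqnn orbT.
exists (r m); split => // j jk; apply: (iter_wshiftV_eq0 Phi_iso); apply: YM.
have := r_ge m; have : ((M + k).+1 <= m)%N by rewrite leq_max leqnn orbT.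
lia.
Qed.

(* The vector is the formal sum of the [S^(n k) (Y k)]; its partial sums are eventually
   constant in each coordinate. *)
Lemma universal_vector : exists (x : int -> A) (n : nat -> nat),
  (exists B, l1_bound x B) /\
  forall m, l1_bound (fun j => iter (n m) T x j - Y m j) (3 * q m).
Proof.
have C0 : 0 < C := lt_le_trans ltr01 C1.
have /choice[nx nxP] (u : nat * nat * (int -> A)) : exists n,
    null_vector Phi PhiV b binv r u.2 ->
    [/\ l1_bound (iter n T u.2) (q u.1.1),
        l1_bound (iter n S (Y u.1.1)) (q u.1.1 / C ^+ u.1.2)
      & forall j, (`|j| <= u.1.1)%N -> iter n S (Y u.1.1) j = 0].
  have [/(next_time u.1.1 u.1.2)[n nP]|uN] := pselect (null_vector Phi PhiV b binv r u.2).
    by exists n.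
  by exists 0%N.
(* The state is the sum of the chosen times, which bounds each of them, together with the partial
   sum of the vector. *)
pose st := fix st k : nat * (int -> A) := if k is k'.+1 then
    let n := nx (k', (st k').1, (st k').2) in
    (((st k').1 + n)%N, fun j => (st k').2 j + iter n S (Y k') j)
  else (0%N, fun=> 0).
pose N k := (st k).1; pose X k := (st k).2; pose n k := nx (k, N k, X k).
pose z k := iter (n k) S (Y k).
have XS k : X k.+1 = fun j => X k j + z k j by [].
have NS k : N k.+1 = (N k + n k)%N by [].
have X_null k : null_vector Phi PhiV b binv r (X k).
  elim: k => [|k IH]; first exact: (null_vector0 Phi_iso eP bK).
  by rewrite XS; apply: (null_vectorD Phi_iso) => //; exact: iter_wshiftV_null.
have nP k := nxP (k, N k, X k) (X_null k).
have nN m K : (m < K)%N -> (n m <= N K)%N.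
  elim: K => // K IH; rewrite ltnS leq_eqVlt NS => /orP[/eqP ->|/IH mK].
    exact: leq_addl.
  by rewrite (leq_trans mK) ?leq_addr.
(* The summands from index [|j|] on vanish at [j], so this is the limit of the partial sums
   there. *)
pose x (j : int) := X `|j|%N j.
have xX K j : (`|j| <= K)%N -> X K j = x j.
  move=> /subnKC <-; elim: (K - _)%N => [|i IH]; first by rewrite addn0.
  have [_ _ z0] := nP (`|j| + i)%N.
  by rewrite addnS XS IH /z z0 ?addr0//= leq_addr.
(* The term [- 2 q K] makes the induction telescope: step [K] adds [q K = 2 q K - 2 q (K + 1)]. *)
have bound m K : (m < K)%N ->
    l1_bound (fun j => iter (n m) T (X K) j - Y m j) (3 * q m - 2 * q K).
  have qS k : q k = 2 * q k.+1 by rewrite /q exprS mulrA mulfV ?mul1r.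
  elim: K => // K IH; rewrite ltnS leq_eqVlt XS (iter_wshiftD Phi_iso) => /orP[/eqP ->|mK].
    have [Tn _ _] := nP K; rewrite /= in Tn.
    apply: l1_bound_trans (l1_bound_le Tn _) => [|j].
      by have := q0 K; rewrite (qS K); lra.
    by rewrite /z (iter_wshiftVK Phi_iso eP bK) addrK.
  have -> : (fun j => iter (n m) T (X K) j + iter (n m) T (z K) j - Y m j) =
      (fun j => (iter (n m) T (X K) j - Y m j) + iter (n m) T (z K) j).
    by apply/funext => j; rewrite addrAC.
  apply: l1_bound_trans (l1_boundD (IH mK) (_ : l1_bound _ (q K))).
    by rewrite (qS K); lra.
  have [_ zK _] := nP K; rewrite -/(z K) /= in zK.
  apply: l1_bound_trans (l1_bound_iter_wshift Phi_iso C1 bC (n m) zK).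
  rewrite mulrCA -[leRHS]mulr1 ler_wpM2l// ?(ltW (q0 K))// ler_pdivrMr ?exprn_gt0// mul1r.
  by rewrite ler_weXn2l// nN.
have final m : l1_bound (fun j => iter (n m) T x j - Y m j) (3 * q m).
  move=> F; pose K := maxn m.+1 (\max_(j <- F) `|j - (n m)%:Z|%N).
  have mK : (m < K)%N by rewrite leq_max leqnn.
  have := bound m K mK F; rewrite big_seq [in X in _ -> X]big_seq.
  have -> : \sum_(j <- F | j \in F) rnorm (iter (n m) T (X K) j - Y m j) =
      \sum_(j <- F | j \in F) rnorm (iter (n m) T x j - Y m j).
    apply: eq_bigr => j jF; congr (rnorm (_ - _)); apply: iter_wshift_local.
    apply: xX; rewrite leq_max; apply/orP; right.
    exact: (@leq_bigmax_seq _ _ _ (fun j : int => `|j - (n m)%:Z|%N)) jF isT.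
  by have := q0 K; lra.
exists x, n; split => //.
(* The l^1 bound on [x] comes from one on [T^(n 0) x], which is close to the finitely supported
   [Y 0], by applying [S^(n 0)]. *)
have [[M YM] _] := Y_null 0.
pose J : {fset int} := [fset (i%:Z - M%:Z : int) | i in iota 0 (M + M).+1]%fset.
have YJ : l1_bound (Y 0%N) (\sum_(j <- J) rnorm (Y 0%N j)).
  apply: l1_bound_fsupp => j; apply: contraNeq => Yj.
  have jM : (`|j| <= M)%N by rewrite leqNgt; apply: contra_neqN Yj; exact: YM.
  apply/imfsetP; exists `|(j + M%:Z)%R|%N; last by lia.
  by rewrite inE mem_iota; lia.
have Tx : l1_bound (iter (n 0) T x) (3 * q 0 + \sum_(j <- J) rnorm (Y 0%N j)).
  apply: l1_bound_le (l1_boundD (final 0%N) YJ) _ => j.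
  by rewrite subrK.
have := l1_bound_iter_wshiftV Phi_iso C1 binvC (n 0) Tx.
by rewrite (iter_wshiftK Phi_iso eP bK) => xB; eexists; exact: xB.
Qed.

End Construction.

(** Pigeonhole. It is used to find arbitrarily late codes of one and the same vector. *)
Lemma injective_unbounded (f : nat -> nat) N : injective f -> exists i, (N <= f i)%N.
Proof.
move=> f_inj; apply: contrapT => fN.
have f_lt i : (f i < N)%N by rewrite ltnNge; apply/negP => ?; apply: fN; exists i.
have : injective (fun i : 'I_N.+1 => Ordinal (f_lt i)).
  by move=> i j [] /f_inj/val_inj.
by move/leq_card; rewrite !card_ord ltnn.
Qed.

(** * A countable dense family of finitely supported vectors *)

Section DenseFamily.
Variables (R : realType) (A : cstarAlgType R).
Implicit Types (a v y : int -> A).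

#[local] Existing Instance totally_filter.

(** On sets containing [F], the partial sums for [t] are those for [y] minus the one over [F]. The
    sign of [t] fits the later splitting of [T^n x - y]. *)
Lemma l2_tail y (d : R) : l2 A y -> 0 < d -> exists F : {fset int},
  let t := fun j => if j \in F then 0 else - y j in l2 A t /\ l2norm A t ^+ 2 <= d.
Proof.
move=> yl d0; have d2 : 0 < d / 2 by rewrite divr_gt0.
have /cvg_rnormP/(_ _ d2)[F _ yF] := l2_cvg yl; exists F => t.
set s := summability.sum _ in yF; set ps := partial_sum _ in yF.
have tl : partial_sum (fun j => cmul (adj (t j)) (t j)) @ totally --> s - ps F.
  apply/cvg_rnormP => eps eps0.
  have /cvg_rnormP/(_ _ eps0)[G _ yG] := l2_cvg yl.
  exists (G `|` F)%fset => // H /=; rewrite fsubUset => /andP[GH FH].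
  have -> : partial_sum (fun j => cmul (adj (t j)) (t j)) H = ps H - ps F.
    rewrite /ps !partial_sumE [in RHS](big_fsetID _ (mem F) H)/=.
    have -> : [fset x in H | x \in F]%fset = F.
      apply/fsetP => x; rewrite !inE /=; apply/andP/idP => [[]//|xF].
      by split=> //; exact: (fsubsetP FH).
    rewrite addrAC subrr add0r [LHS](big_fsetID _ (mem F) H)/=.
    rewrite big_seq big1 ?add0r => [|j]; last first.
      by rewrite !inE/= /t => /andP[_ ->]; rewrite cmul0.
    rewrite big_seq [RHS]big_seq; apply: eq_bigr => j.
    rewrite !inE/= /t => /andP[_ /negPf ->].
    by rewrite -scaleN1r adjZ cmulZl cmulZr scalerA rmorphN1 mulrNN mulr1 scale1r.
  by rewrite opprB addrA subrK; exact: yG.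
split; first by apply/cvg_ex; eexists; exact: tl.
rewrite l2norm_sqr /summability.sum (cvg_lim _ tl)//.
apply: ltW; apply: lt_le_trans (yF F (fsubset_refl _)) _.
by rewrite ler_pdivrMr// ler_peMr ?(ltW d0)// ler1n.
Qed.

Variable u : nat -> A.
Hypothesis u_dense : forall x (eps : R), 0 < eps -> exists n, rnorm (x - u n) < eps.

(** Lists of pairs (coordinate, index into the dense sequence) can be enumerated by [pickle]. *)
Definition finite_vector (s : seq (int * nat)) : int -> A :=
  fun j => \sum_(p <- s) delta p.1 (u p.2) j.

Lemma finite_vector_dense y (F : seq int) (eta : R) : uniq F -> 0 < eta ->
  exists s, l1_bound (fun j => (if j \in F then y j else 0) - finite_vector s j) eta.
Proof.
elim: F eta => [|i F IH] eta /=.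
  move=> _ eta0; exists [::] => G; rewrite big1 ?ltW// => j _.
  by rewrite /finite_vector big_nil subrr rnorm0.
move=> /andP[iF Funiq] eta0; have eta2 : 0 < eta / 2 by rewrite divr_gt0.
have [s sP] := IH _ Funiq eta2; have [n yn] := u_dense (y i) eta2.
exists ((i, n) :: s); rewrite (splitr eta).
have := l1_boundD sP (l1_bound_trans (ltW yn) (@l1_bound_delta _ _ i (y i - u n))).
move=> H; apply: l1_bound_le H _ => j; rewrite /finite_vector big_cons /= inE /delta.
case: eqVneq => [->|_] /=; last by rewrite add0r addr0.
by rewrite (negPf iF) sub0r opprD addrA addrC.
Qed.

End DenseFamily.

Section WeightConditionImpliesHypercyclic.
Variables (R : realType) (A : cstarAlgType R).
Hypothesis cmulC : commutative (@cmul R A).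
Variable e : A.
Hypothesis eP : is_unit_of e.

(** The coordinate 0 of a countable dense subset of l^2 is dense in [A], because characters bound
    the norm of a coordinate by the l^2 norm. *)
Lemma separable_l2 : separable (l2 A) (l2norm A) ->
  exists u : nat -> A, forall x (eps : R), 0 < eps -> exists n, rnorm (x - u n) < eps.
Proof.
move=> [D /countable_injP[f f_inj] [Dl2 Ddense]].
pose d n : int -> A := xget 0 [set a | D a /\ f a = n].
exists (fun n => d n 0) => x eps eps0.
have xB := l1_bound_delta 0 x; have [a Da a_lt] := Ddense _ (l1_bound_l2 xB) _ eps0.
exists (f a).
have -> : d (f a) = a.
  apply: xget_unique; first by split.
  by move=> c [Dc fc]; apply: f_inj; rewrite ?inE.
apply: le_lt_trans a_lt; have [K K0 aK] := l2_bounded (Dl2 _ Da).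
have NxB : l1_bound (fun j => - delta 0 x j) (rnorm x).
  by apply: l1_bound_le xB _ => j; rewrite rnormN.
have [al2 _] := l2_perturb (Dl2 _ Da) aK NxB.
apply: (rnorm_le_char cmulC eP) => [|h hP]; first exact: l2norm_ge0.
rewrite (charB hP) rdistrC -(charB hP).
by have := char_le_l2norm 0 hP al2; rewrite [delta 0 x 0]/delta eqxx; exact.
Qed.

Variables (Phi PhiV : A -> A).
Hypothesis Phi_iso : isometric_star_iso Phi PhiV.
Variables b binv : int -> A.
Hypothesis bK : forall j, cmul (b j) (binv j) = e /\ cmul (binv j) (b j) = e.

Lemma weight_condition_spectrum : spectrum A !=set0 -> weight_condition Phi PhiV b ->
  exists2 r : nat -> nat, {homo r : k l / (k < l)%N} &
    forall eps : R, 0 < eps -> exists k0, forall k (h : A -> R[i]),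
      (k0 <= k)%N -> spectrum A h ->
      \prod_(1 <= i < (r k).+1) rnorm (h (iter i PhiV (b (i%:Z + 1)))) <= eps /\
      1 <= eps * \prod_(1 <= i < (r k).+1) rnorm (h (iter i.-1 Phi (b (1 - i%:Z + 1)))).
Proof.
move=> spec0 W.
have [||||r [_ r_mono rW]] := W (spectrum A) spec0 (spectrum_compact eP) _ [set 1%N].
- by [].
- by exists 1%N.
- exact: finite_set1.
- by move=> j ->.
have [W1 W2] := rW 1%N erefl.
exists r => // eps eps0.
have [k1 E1] := ereal_sup_image_cvg0_lt W1 eps0.
have [k2 E2] := ereal_sup_image_cvg0_lt W2 eps0.
exists (maxn k1 k2) => k h; rewrite geq_max => /andP[/E1 {}E1 /E2 {}E2] hP; split.
  by have := E1 h hP; rewrite prodEFin lte_fin => /ltW.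
(* Invertible weights have nonzero values, so the inverses in the extended reals are finite. *)
have b_neq0 i j : h (iter i Phi (b j)) != 0.
  have hi := spectrum_iter_iso Phi_iso i hP.
  apply: contra_eq_neq (char1 eP hi); rewrite -(bK j).1 (charM hi) /= => ->.
  by rewrite mul0r eq_sym oner_neq0.
have P0 : 0 < \prod_(1 <= i < (r k).+1) rnorm (h (iter i.-1 Phi (b (1 - i%:Z + 1)))).
  by apply: prodr_gt0 => i _; exact: rnorm_gt0.
have := E2 h hP; rewrite prode_inv ?gt_eqF// lte_fin => /ltW.
by rewrite -[_^-1]mul1r ler_pdivrMr.
Qed.

Hypothesis b_bounded : exists M : R, forall j, rnorm (b j) <= M.
Hypothesis binv_bounded : exists M : R, forall j, rnorm (binv j) <= M.

Lemma weight_condition_hypercyclic : separable (l2 A) (l2norm A) ->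
  spectrum A !=set0 -> weight_condition Phi PhiV b ->
  hypercyclic (l2 A) (l2norm A) (bilateral_shift Phi b).
Proof.
move=> /separable_l2[u u_dense] spec0 /(weight_condition_spectrum spec0)[r r_mono rP].
have [M bM] := b_bounded; have [M' binvM] := binv_bounded.
pose C := Num.max 1 (Num.max M M').
have C1 : 1 <= C by rewrite le_max lexx.
have bC j : rnorm (b j) <= C by rewrite !le_max bM orbT.
have binvC j : rnorm (binv j) <= C by rewrite !le_max binvM !orbT.
(* [m] codes a pair [(i, s)] whose first entry is dropped, so each list [s] recurs infinitely often;
   other [m] give the empty list. *)
pose Y m := finite_vector u
  (odflt [::] (omap snd (choice.unpickle m : option (nat * seq (int * nat))))).
have fin_null s : null_vector Phi PhiV b binv r (finite_vector u s).
  elim: s => [|p s IH].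
    rewrite (_ : finite_vector u [::] = fun=> 0); first exact: (null_vector0 Phi_iso eP bK).
    by apply/funext => j; rewrite /finite_vector big_nil.
  rewrite (_ : finite_vector u (p :: s) =
    fun j => delta p.1 (u p.2) j + finite_vector u s j).
    apply: (null_vectorD Phi_iso) => //.
    exact: (null_vector_delta cmulC Phi_iso eP bK C1 bC binvC rP).
  by apply/funext => j; rewrite /finite_vector big_cons.
have [x [n [[B xB] xY]]] := universal_vector Phi_iso eP bK C1 bC binvC r_mono
  (fun m => fin_null _ : null_vector Phi PhiV b binv r (Y m)).
have TxB k : l1_bound (iter k (wshift Phi b) x) (C ^+ k * B).
  exact: (l1_bound_iter_wshift Phi_iso C1 bC k xB).
exists x; first exact: l1_bound_l2 xB.
split => [_ [k _ <-]|y yl eps eps0].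
  by rewrite (bilateral_shiftE cmulC Phi_iso); exact: l1_bound_l2 (TxB k).
(* The tail and the perturbation each contribute at most [eps^2 / 4] to the squared norm. *)
have d0 : 0 < eps ^+ 2 / 4 by rewrite divr_gt0// exprn_gt0.
have [F [tl t_le]] := l2_tail yl d0; set t := (fun j : int => _) in tl t_le.
have [K K0 tK] := l2_bounded tl.
(* With [eta <= 1], the perturbation term satisfies [(2 K + eta) eta <= (2 K + 1) eta <= eps^2 /
   4]. *)
pose eta := Num.min 1 (eps ^+ 2 / 4 / (2 * K + 1)).
have K1 : 0 < 2 * K + 1 by rewrite ltr_wpDl// mulr_ge0.
have eta0 : 0 < eta by rewrite lt_min ltr01 divr_gt0.
have eta2 : 0 < eta / 2 by rewrite divr_gt0.
have [s sP] := finite_vector_dense u_dense y (fset_uniq F) eta2.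
have [|||N qN] := @exprn_lt_near R 2^-1 (eta / 6); [lra|lra|lra|].
have [i iN] := @injective_unbounded (fun i => choice.pickle (i, s)) N
  ltac:(by move=> i j /(pcan_inj choice.pickleK) []).
set m := choice.pickle (i, s) in iN.
have Ym : Y m = finite_vector u s by rewrite /Y /m choice.pickleK.
have q_le : 3 * 2^-1 ^+ m <= eta / 2.
  have : (2^-1 : R) ^+ m <= 2^-1 ^+ N by rewrite ler_wiXn2l//; lra.
  by move: qN; lra.
exists (bilateral_shift Phi b (n m) x); first by exists (n m).
rewrite (bilateral_shiftE cmulC Phi_iso).
have vB : l1_bound (fun j => (iter (n m) (wshift Phi b) x j - Y m j) -
    ((if j \in F then y j else 0) - finite_vector u s j)) eta.
  rewrite (splitr eta); apply: l1_boundD; first exact: l1_bound_trans q_le (xY m).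
  by apply: l1_bound_le sP _ => j; rewrite rnormN.
have [_] := l2_perturb tl tK vB.
set w := (X in l2norm A X).
have -> : w = iter (n m) (wshift Phi b) x - y.
  apply/funext => j; rewrite /w /t Ym opprB [X in _ + X]addrA subrK.
  rewrite (_ : (iter (n m) (wshift Phi b) x - y) j = iter (n m) (wshift Phi b) x j - y j)//.
  by case: ifP => _; [rewrite add0r|rewrite subr0 addrC].
move=> w_le; rewrite -(@ltr_pXn2r _ 2) ?nnegrE ?l2norm_ge0 ?(ltW eps0)//.
apply: le_lt_trans w_le _.
have eta1 : eta <= 1 by rewrite ge_min lexx.
have etaK : (2 * K + 1) * eta <= eps ^+ 2 / 4.
  by rewrite mulrC -ler_pdivlMr// ge_min lexx orbT.
have : (2 * K + eta) * eta <= (2 * K + 1) * eta by rewrite ler_wpM2r ?(ltW eta0)// lerD2l.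
lra.
Qed.

End WeightConditionImpliesHypercyclic.

Theorem theorem2p2 (R : realType) (A : cstarAlgType R)
    (cmulC : commutative (@cmul R A))
    (l2_separable : separable (l2 A) (l2norm A))
    (l2_infinite_dimensional : infinite_dimensional (l2 A))
    (Phi PhiV : A -> A) (Phi_iso : isometric_star_iso Phi PhiV)
    (b : int -> A) (b_bounded : exists M : R, forall j, rnorm (b j) <= M) :
  (hypercyclic (l2 A) (l2norm A) (bilateral_shift Phi b) ->
     weight_condition Phi PhiV b)
  /\
  (forall (e : A), is_unit_of e ->
   forall (binv : int -> A),
     (forall j, cmul (b j) (binv j) = e /\ cmul (binv j) (b j) = e) ->
     (exists M : R, forall j, rnorm (binv j) <= M) ->
   weight_condition Phi PhiV b ->
     hypercyclic (l2 A) (l2norm A) (bilateral_shift Phi b)).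
Proof.
split=> [|e eP binv bK binv_bounded]; first exact: hypercyclic_weight_condition.
apply: (weight_condition_hypercyclic cmulC eP Phi_iso bK) => //.
(* Infinite dimension, used with the empty family, gives a nonzero vector and hence a character: (2)
   concerns non-empty [K] only. *)
have [v _ v0] := l2_infinite_dimensional 0%N (fun=> 0) (fun i => (l2_0 A).1).
have [j vj] : exists j, v j != 0.
  apply: contrapT => v_eq0; apply: (v0 (fun=> 0)); rewrite big_ord0.
  apply/funext => j; apply/eqP; apply: contraT => vj.
  by case: v_eq0; exists j.
by have [h hP _] := gelfand cmulC eP vj; exists h.
Qed.
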